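(* Let $G$ be a Lie group (in Milnor's sense, modeled over a Hausdorff locally convex vector space). If $G$ is $C^\infty$-semiregular, then $G$ is Mackey complete.
   Context: Calculus: for Hausdorff locally convex vector spaces $F,E$ and $U\subseteq F$ open, a map $f:U\to E$ is differentiable at $x$ if $D_vf(x)=\lim_{t\to 0}\frac1t(f(x+tv)-f(x))$ exists in $E$ for every $v\in F$; it is $C^0$ if continuous, $C^k$ ($k\ge 1$) if all iterated directional derivatives $D_{v_p}\cdots D_{v_1}f$ ($p\le k$) exist and $(x,v_1,\dots,v_p)\mapsto D_{v_p}\cdots D_{v_1}f(x)$ is continuous on $U\times F^p$ for $0\le p\le k$; $C^\infty$ (smooth) if $C^k$ for all $k$. $G$ is a Lie group in Milnor's sense: a group that is a smooth Hausdorff manifold (in this calculus) modeled on a Hausdorff locally convex vector space $E$, with smooth multiplication and inversion. $e$ is the unit, $\mathfrak g=T_eG$ the Lie algebra, $\mathrm R_g(h)=hg$. $\mathfrak P$ is the set of continuous seminorms on $E$. $\Xi:G\supseteq\mathcal U\to\mathcal V\subseteq E$ is a fixed chart with $e\in\mathcal U$, $\Xi(e)=0$, $\mathcal V$ convex. An assertion such as $(\mathfrak p\circ\Xi)(g)\le c$ includes that $g\in\mathcal U$. A curve on a compact interval $[r,r']$ ($r<r'$) is $C^k$ if it is the restriction of a $C^k$-curve defined on an open interval containing $[r,r']$. The right logarithmic derivative of $\mu\in C^1([0,1],G)$ is $\delta^r(\mu)(t)=d_{\mu(t)}\mathrm R_{\mu(t)^{-1}}(\dot\mu(t))$, so $\delta^r(\mu)\in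 C^0([0,1],\mathfrak g)$. $G$ is $C^\infty$-semiregular if every $\phi\in C^\infty([0,1],\mathfrak g)$ is of the form $\phi=\delta^r(\mu)$ for some $\mu\in C^1([0,1],G)$. A sequence $\{g_n\}_{n\in\mathbb N}\subseteq G$ is a Mackey-Cauchy sequence if there exist constants $\{c_{\mathfrak p}\}_{\mathfrak p\in\mathfrak P}\subseteq\mathbb R_{\ge0}$, $\{l_{\mathfrak p}\}_{\mathfrak p\in\mathfrak P}\subseteq\mathbb N$ and numbers $\lambda_{m,n}\ge 0$ ($(m,n)\in\mathbb N\times\mathbb N$) with $\lambda_{m,n}\to 0$ as $(m,n)\to\infty$ such that $(\mathfrak p\circ\Xi)(g_m^{-1}g_n)\le c_{\mathfrak p}\,\lambda_{m,n}$ for all $m,n\ge l_{\mathfrak p}$ and all $\mathfrak p\in\mathfrak P$. $G$ is Mackey complete if every Mackey-Cauchy sequence in $G$ converges in $G$. (This does not depend on the choice of $\Xi$.) *)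

(* Defs.v *)
From HB Require Import structures.
From mathcomp Require Import all_boot all_order all_algebra.
From mathcomp Require Import all_classical all_reals all_analysis.
Set Implicit Arguments.
Unset Strict Implicit.
Unset Printing Implicit Defensive.
Import Order.TTheory GRing.Theory Num.Theory.
Import numFieldNormedType.Exports.

Local Open Scope classical_set_scope.
Local Open Scope ring_scope.

Section Calculus.
Context {R : realType} {F E : tvsType R}.

(* The library's [derive] requires normed modules. *)
Definition is_dderive (f : F -> E) (x v : F) (l : E) : Prop :=
  (fun t : R => t^-1 *: (f (x + t *: v) - f x)) @ 0^' --> l.

Definition dderivable (f : F -> E) (x v : F) : Prop :=
  exists l, is_dderive f x v l.

(* The limit, which is unique when E is Hausdorff, or 0 if there is none. *)
Definition dderive (f : F -> E) (x v : F) : E :=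
  xget 0 [set l | is_dderive f x v l].

(* [iter_dderive f [:: v_1; ...; v_p]] is D_{v_p} ... D_{v_1} f. *)
Definition iter_dderive (f : F -> E) (vs : seq F) : F -> E :=
  foldl (fun g v x => dderive g x v) f vs.

(* f is C^k on U; meant for U open, so that the values of f outside U do not
   matter.  F^p is ['I_p -> F] with the product topology. *)
Definition Ck_on (k : nat) (U : set F) (f : F -> E) : Prop :=
  (forall (vs : seq F) (v x : F), (size vs < k)%N -> U x ->
     dderivable (iter_dderive f vs) x v) /\
  (forall p : nat, (p <= k)%N ->
     {within U `*` [set: {ptws 'I_p -> F}],
       continuous (fun xv : F * {ptws 'I_p -> F} =>
         iter_dderive f [seq xv.2 i | i <- enum 'I_p] xv.1)}).

Definition smooth_on (U : set F) (f : F -> E) : Prop :=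
  forall k, Ck_on k U f.

End Calculus.

Section Manifolds.
Context {R : realType}.

Record chart (M : topologicalType) (F : tvsType R) := Chart {
  dom : set M;
  cod : set F;
  fwd :> M -> F;
  bwd : F -> M;
  dom_open : open dom;
  cod_open : open cod;
  fwd_cod : forall m, dom m -> cod (fwd m);
  bwd_dom : forall x, cod x -> dom (bwd x);
  fwdK : forall m, dom m -> bwd (fwd m) = m;
  bwdK : forall x, cod x -> fwd (bwd x) = x;
  fwd_continuous : {within dom, continuous fwd};
  bwd_continuous : {within cod, continuous bwd} }.

Definition transition_smooth (M : topologicalType) (F : tvsType R)
    (a b : chart M F) : Prop :=
  smooth_on [set x | cod a x /\ dom b (bwd a x)] (b \o bwd a).

Definition compatible (M : topologicalType) (F : tvsType R)
    (a b : chart M F) : Prop :=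
  transition_smooth a b /\ transition_smooth b a.

Definition smooth_structure (M : topologicalType) (F : tvsType R)
    (A : set (chart M F)) : Prop :=
  [/\ forall m, exists2 a, A a & dom a m,
      forall a b, A a -> A b -> compatible a b &
      forall a, (forall b, A b -> compatible a b) -> A a].

(* f is a C^k map on the open subset W of M, where M and N are manifolds with
   (not necessarily maximal) atlases A and B. *)
Definition mfd_Ck (M N : topologicalType) (F E : tvsType R)
    (A : set (chart M F)) (B : set (chart N E))
    (k : nat) (W : set M) (f : M -> N) : Prop :=
  {within W, continuous f} /\
  forall a b, A a -> B b ->
    Ck_on k [set x | [/\ cod a x, W (bwd a x) & dom b (f (bwd a x))]]
      (b \o f \o bwd a).

Definition mfd_smooth (M N : topologicalType) (F E : tvsType R)
    (A : set (chart M F)) (B : set (chart N E)) (f : M -> N) : Prop :=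
  forall k, mfd_Ck A B k setT f.

Section IdChart.
Variable F : tvsType R.

Let id_cont : {within [set: F], continuous (@id F)}.
Proof. by apply: continuous_subspaceT => x; exact: cvg_id. Qed.

Definition id_chart : chart F F :=
  @Chart F F setT setT id id openT openT (fun _ h => h) (fun _ h => h)
    (fun _ _ => erefl) (fun _ _ => erefl) id_cont id_cont.
End IdChart.

Section ProdChart.
Variables (M N : topologicalType) (F E : tvsType R).
Variables (a : chart M F) (b : chart N E).

Let pfwd (z : M * N) : F * E := (a z.1, b z.2).
Let pbwd (z : F * E) : M * N := (bwd a z.1, bwd b z.2).

Let open_setX (S T : topologicalType) (X : set S) (Y : set T) :
  open X -> open Y -> open (X `*` Y).
Proof.
move=> oX oY; rewrite openE => -[x y] [/= Xx Yy].
by exists (X, Y) => //=; split; exact: open_nbhs_nbhs.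
Qed.

Let within_pair (S T S' T' : topologicalType) (X : set S) (Y : set T)
    (f : S -> S') (g : T -> T') : open X -> open Y ->
  {within X, continuous f} -> {within Y, continuous g} ->
  {within X `*` Y, continuous (fun z => (f z.1, g z.2))}.
Proof.
move=> oX oY; rewrite continuous_open_subspace// continuous_open_subspace//.
move=> cf cg; rewrite continuous_open_subspace; last exact: open_setX.
move=> -[x y]; rewrite inE => -[/= Xx Yy]; apply: cvg_pair.
- apply: (@cvg_comp _ _ _ fst f _ (nbhs x)); first exact: cvg_fst.
  by apply: cf; rewrite inE.
- apply: (@cvg_comp _ _ _ snd g _ (nbhs y)); first exact: cvg_snd.
  by apply: cg; rewrite inE.
Qed.

Let pfwd_cod m : (dom a `*` dom b) m -> (cod a `*` cod b) (pfwd m).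
Proof. by case=> ? ?; split; exact: fwd_cod. Qed.

Let pbwd_dom x : (cod a `*` cod b) x -> (dom a `*` dom b) (pbwd x).
Proof. by case=> ? ?; split; exact: bwd_dom. Qed.

Let pfwdK m : (dom a `*` dom b) m -> pbwd (pfwd m) = m.
Proof. by case: m => m n [/= ? ?]; rewrite /pbwd /= !fwdK. Qed.

Let pbwdK x : (cod a `*` cod b) x -> pfwd (pbwd x) = x.
Proof. by case: x => x y [/= ? ?]; rewrite /pfwd /= !bwdK. Qed.

Let pfwd_continuous : {within dom a `*` dom b, continuous pfwd}.
Proof.
by apply: within_pair;
  [exact: dom_open|exact: dom_open|exact: fwd_continuous|exact: fwd_continuous].
Qed.

Let pbwd_continuous : {within cod a `*` cod b, continuous pbwd}.
Proof.
by apply: within_pair;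
  [exact: cod_open|exact: cod_open|exact: bwd_continuous|exact: bwd_continuous].
Qed.

Definition prod_chart : chart (M * N)%type (F * E)%type :=
  Chart (open_setX (dom_open a) (dom_open b))
    (open_setX (cod_open a) (cod_open b)) pfwd_cod pbwd_dom pfwdK pbwdK
    pfwd_continuous pbwd_continuous.
End ProdChart.

Definition prod_atlas (M N : topologicalType) (F E : tvsType R)
    (A : set (chart M F)) (B : set (chart N E)) :
    set (chart (M * N)%type (F * E)%type) :=
  [set c | exists a b, [/\ A a, B b & c = prod_chart a b]].

(* A tangent vector at m, given by its coordinates in all charts around m,
   which are related by the differentials of the transition maps. *)
Record tangent (M : topologicalType) (F : tvsType R) (A : set (chart M F))
    (m : M) := Tangent {
  coord : chart M F -> F;
  coord_transition : forall a b, A a -> A b -> dom a m -> dom b m ->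
    coord b = dderive (b \o bwd a) (a m) (coord a);
  coord_junk : forall a, ~ (A a /\ dom a m) -> coord a = 0 }.

(* w is the image of v under the tangent map of f at m. *)
Definition tangent_map (M N : topologicalType) (F E : tvsType R)
    (A : set (chart M F)) (B : set (chart N E)) (f : M -> N)
    (m : M) (n : N) (v : tangent A m) (w : tangent B n) : Prop :=
  f m = n /\
  forall a b, A a -> dom a m -> B b -> dom b n ->
    coord w b = dderive (b \o f \o bwd a) (a m) (coord v a).

(* The curve mu is represented by a function on R, of which only the values
   near [r, s] matter. *)
Definition curve_Ck (M : topologicalType) (F : tvsType R)
    (A : set (chart M F)) (k : nat) (r s : R) (mu : R^o -> M) : Prop :=
  exists r' s' : R, [/\ r' < r, s < s' &
    mfd_Ck [set id_chart R^o] A k [set` `]r', s'[%R] mu].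

(* v is the velocity of the curve mu at t. *)
Definition velocity (M : topologicalType) (F : tvsType R)
    (A : set (chart M F)) (mu : R^o -> M) (t : R) (v : tangent A (mu t)) :
    Prop :=
  forall a, A a -> dom a (mu t) -> coord v a = dderive (a \o mu) t 1.

(* The locally convex structure of the tangent space at m is the one for which
   [coord ^~ a] is a linear homeomorphism onto F for every chart a around m, so
   a curve is smooth if and only if its coordinates in these charts are. *)
Definition tangent_curve_smooth (M : topologicalType) (F : tvsType R)
    (A : set (chart M F)) (m : M) (r s : R) (phi : R^o -> tangent A m) : Prop :=
  exists r' s' : R, [/\ r' < r, s < s' &
    forall a, A a -> dom a m ->
      smooth_on [set` `]r', s'[%R] (fun t => coord (phi t) a)].

End Manifolds.

#[short(type="preTopologicalGroupType")]
HB.structure Definition PreTopologicalGroup := {G of Topological G & Group G}.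

Section LieGroups.
Context {R : realType} {E : tvsType R} {G : preTopologicalGroupType}.

Definition lie_group (A : set (chart G E)) : Prop :=
  [/\ hausdorff_space G, smooth_structure A,
      mfd_smooth (prod_atlas A A) A (fun gh : G * G => (gh.1 * gh.2)%g) &
      mfd_smooth A A (fun g : G => g^-1%g)].

Definition right_logder (A : set (chart G E)) (mu : R^o -> G) (t : R)
    (xi : tangent A 1%g) : Prop :=
  exists2 v : tangent A (mu t), velocity v &
    tangent_map (fun h : G => (h * (mu t)^-1)%g) v xi.

Definition Cinfty_semiregular (A : set (chart G E)) : Prop :=
  forall phi : R^o -> tangent A 1%g, tangent_curve_smooth 0 1 phi ->
    exists2 mu : R^o -> G, curve_Ck A 1 0 1 mu &
      forall t : R, 0 <= t <= 1 -> right_logder mu t (phi t).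

Definition continuous_seminorm (p : E -> R) : Prop :=
  [/\ forall x y, p (x + y) <= p x + p y,
      forall (a : R) x, p (a *: x) = `|a| * p x &
      continuous p].

Definition mackey_cauchy (Xi : chart G E) (g : nat -> G) : Prop :=
  exists (c : (E -> R) -> R) (l : (E -> R) -> nat) (lam : nat -> nat -> R),
    [/\ forall p, continuous_seminorm p -> 0 <= c p,
        forall m n, 0 <= lam m n,
        lam mn.1 mn.2 @[mn --> (\oo, \oo)] --> 0 &
        forall p, continuous_seminorm p -> forall m n,
          (l p <= m)%N -> (l p <= n)%N ->
          dom Xi ((g m)^-1 * g n)%g /\
          p (Xi ((g m)^-1 * g n)%g) <= c p * lam m n].

Definition mackey_complete (Xi : chart G E) : Prop :=
  forall g : nat -> G, mackey_cauchy Xi g ->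
    exists h : G, g n @[n --> \oo] --> h.

End LieGroups.

(* Main.v *)
Require Import Defs.
From mathcomp Require Import all_boot all_order all_algebra.
From mathcomp Require Import all_classical all_reals all_analysis.
From mathcomp Require Import ring lra.
Set Implicit Arguments.
Unset Strict Implicit.
Unset Printing Implicit Defensive.
Import Order.TTheory GRing.Theory Num.Theory.
Import numFieldNormedType.Exports.
Local Open Scope classical_set_scope.
Local Open Scope ring_scope.

(** Let [g] be a Mackey-Cauchy sequence.  Along a subsequence [K] that grows
    fast enough, the vectors x_n = Xi (g_{K(n+1)}^-1 g_{K n}) decrease faster
    than any geometric sequence in every continuous seminorm.  The segments
    from 0 to x_n, run through one after the other on the time intervals
    [1 - 2^-n, 1 - 2^-(n+1)], with all derivatives vanishing at the junctions,
    give group-valued curves nu_n(t) = Xi^-1 (rho_n(t) x_n) whose right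
    logarithmic derivatives fit together to one curve phi on [0, 1).  The decay
    of x_n beats every power of 2^n that differentiation in time produces, so
    phi extends smoothly by 0 to t = 1.  Semiregularity yields a curve mu on
    [0, 1] with logarithmic derivative phi.  On each interval mu and nu_n differ
    by a constant factor, hence mu takes the increment Xi^-1 (x_n) =
    g_{K(n+1)}^-1 g_{K n} there, and g_{K n} mu(1 - 2^-n) does not depend on n.
    As mu is continuous at 1, the subsequence converges, and so does [g],
    since g_{K n}^-1 g_n tends to the unit.

    Smoothness of phi ([evolution_through]) rests on two facts.  First, a sum of
    rescaled bumps with rapidly decreasing coefficients is a smooth curve
    ([rapid_curve]).  Second, if f is smooth and c, c_1, ..., c_p are smooth
    curves, then t |-> D_{c_p(t)} ... D_{c_1(t)} f (c(t)) is a smooth curve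
    ([iter_dderive_Ccurve]): the Leibniz rule expresses its derivative as a sum
    of curves of the same form.  Indeed phi(t) is the derivative of the group
    multiplication, read in the chart, at (alpha(t), iota(alpha(t))) in the
    direction (beta(t), 0), where iota is the inversion and alpha, beta are two
    such sums of bumps.

    The calculus is developed from the mean value theorem in a form that needs
    neither integrals nor completeness ([mean_value_convex]): if the derivative
    of a curve stays in an open convex set, so do its difference quotients.
    From it follow the strict differentiability of C^1 maps
    ([strict_dderive]), the chain rule along curves and the linearity of
    derivatives in the direction.  That mu and nu_n differ by a constant is
    seen on 1-jets ([jet_quotient], [constant_of_jet0]): a curve whose
    velocity vanishes in some chart at each time is constant. *)

(** * Limits in locally convex spaces *)

Section TvsLimits.
Context {R : realType} {E : tvsType R} {T : Type} {F : set_system T}.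
Context {FF : Filter F}.

Lemma tvs_cvgD (f g : T -> E) (a b : E) :
  f @ F --> a -> g @ F --> b -> (fun x => f x + g x) @ F --> a + b.
Proof.
move=> fa gb; apply: (cvg_comp2 fa gb).
exact: (@add_continuous E (a, b)).
Qed.

Lemma tvs_cvgZ (s : T -> R) (f : T -> E) (k : R) (a : E) :
  s @ F --> k -> f @ F --> a -> (fun x => s x *: f x) @ F --> k *: a.
Proof.
move=> fa gb; apply: (cvg_comp2 fa gb).
exact: (@scale_continuous R E (k, a)).
Qed.

Lemma tvs_cvgN (f : T -> E) (a : E) :
  f @ F --> a -> (fun x => - f x) @ F --> - a.
Proof.
move=> fa; rewrite -scaleN1r.
under eq_fun do rewrite -scaleN1r.
by apply: tvs_cvgZ => //; exact: cvg_cst.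
Qed.

Lemma tvs_cvgB (f g : T -> E) (a b : E) :
  f @ F --> a -> g @ F --> b -> (fun x => f x - g x) @ F --> a - b.
Proof. by move=> fa gb; apply: tvs_cvgD => //; exact: tvs_cvgN. Qed.

End TvsLimits.

Section LimitsAtZero.
Context {R : realType}.

Lemma cvg_dnbhs0 (T : Type) (F : set_system T) {FF : Filter F} (h : T -> R) :
  h @ F --> (0 : R) -> (\forall x \near F, h x != 0) -> h @ F --> (0 : R)^'.
Proof.
by move=> h0 hn A A0; apply: filterS2 hn (h0 _ A0) => x hx; apply.
Qed.

Lemma cvg_id0 : (fun h : R => h) @ 0^' --> (0 : R).
Proof. by apply: cvg_within_filter; exact: cvg_id. Qed.

Lemma cvg_shift0 (t : R) : (fun h : R => t + h) @ (0 : R)^' --> t.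
Proof.
rewrite -[X in _ --> X]addr0; apply: cvgD; first exact: cvg_cst.
exact: cvg_id0.
Qed.

Lemma cvg_mulr_dnbhs0 (a : R) : a != 0 ->
  (fun r : R => r * a) @ 0^' --> (0 : R)^'.
Proof.
move=> a0; apply: cvg_dnbhs0; last first.
  by near=> r; rewrite mulf_neq0//; near: r; exact: nbhs_dnbhs_neq.
rewrite -[X in _ --> X](mul0r a); apply: cvgM; last exact: cvg_cst.
exact: cvg_id0.
Unshelve. all: by end_near. Qed.

Lemma cvg_line0 (E : tvsType R) (x v : E) :
  (fun h : R => x + h *: v) @ 0^' --> x.
Proof.
rewrite -[X in _ --> X]addr0 -[X in _ + X](scale0r v).
apply: tvs_cvgD; first exact: cvg_cst.
by apply: tvs_cvgZ; [exact: cvg_id0|exact: cvg_cst].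
Qed.

End LimitsAtZero.

Section Convexity.
Context {R : realType} {E : tvsType R}.

Lemma convex_setP (C : set E) (x y : E) (k : R) : convex_set C ->
  C x -> C y -> 0 <= k -> k <= 1 -> C (k *: x + (1 - k) *: y).
Proof.
move=> cC Cx Cy k0 k1.
have := cC x y (Itv01 k0 k1) (mem_set Cx) (mem_set Cy).
by rewrite inE.
Qed.

Lemma nbhs_convex (x : E) (O : set E) : nbhs x O ->
  exists C : set E, [/\ open C, convex_set C, C x & C `<=` O].
Proof.
have [B cB [oB Bx]] := @locally_convex R E.
move=> /(Bx x) [C [BC Cx] CO]; exists C; split => //.
- exact: oB.
- exact/cB/mem_set.
Qed.

End Convexity.

(** * Mean value theorem *)

(** The supremum of the endpoints that can be reached from [a] cannot lie before
    [b], because an interval around it can be appended. *)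
Lemma cousin (R : realType) (a b : R) (P : R -> R -> Prop) : a <= b ->
  (forall x y z, x <= y -> y <= z -> P x y -> P y z -> P x z) ->
  (forall t, a <= t -> t <= b -> exists2 d : R, 0 < d &
     forall x y, a <= x -> x <= t -> t <= y -> y <= b -> y - x < d -> P x y) ->
  P a b.
Proof.
move=> ab Ptr Ploc.
pose S := [set s | [/\ a <= s, s <= b & P a s]].
have Sa : S a.
  split => //; have [d d0 Pd] := Ploc a (lexx _) ab.
  by apply: Pd => //; rewrite subrr.
have Sb : ubound S b by move=> s [].
have ubS : has_ubound S by exists b.
have supS : has_sup S by split => //; exists a.
set s0 := sup S.
have as0 : a <= s0 by exact: ub_le_sup ubS _ Sa.
have s0b : s0 <= b by apply: ge_sup => //; exists a.
have [d d0 Pd] := Ploc s0 as0 s0b.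
have d20 : 0 < d / 2 by rewrite divr_gt0.
have [s [as_ sb Pas] s0s] := sup_adherent d20 supS.
have ss0 : s <= s0 by apply: ub_le_sup ubS _ _; split.
have key y : s0 <= y -> y <= b -> y <= s0 + d / 2 -> P a y.
  move=> s0y yb ys0; apply: (Ptr _ s) => //; first exact: le_trans s0y.
  apply: Pd => //; rewrite -/s0 in s0s.
  by lra.
have [s0dE|] := leP b (s0 + d / 2); first by apply: key.
move=> lt1; suff : s0 + d / 2 <= s0 by lra.
apply: (ub_le_sup ubS).
by split; [lra|lra|apply: key; lra].
Qed.

Section CurveDerivative.
Context {R : realType} {E : tvsType R}.
Implicit Types (c : R -> E) (C : set E).

Definition cder (c : R -> E) (t : R) (l : E) : Prop :=
  (fun h : R => h^-1 *: (c (t + h) - c t)) @ 0^' --> l.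

Lemma cder_near c (t : R) l (O : set E) : cder c t l -> nbhs l O ->
  exists2 d : R, 0 < d & forall h : R, `|h| < d -> h != 0 ->
    O (h^-1 *: (c (t + h) - c t)).
Proof.
move=> cl /cl /= [d /= d0 dO]; exists d => // h hd h0.
by apply: dO => //=; rewrite sub0r normrN.
Qed.

(** The difference quotient over a union of adjacent intervals is a convex
    combination of those over the parts, and short intervals around a given time
    have their difference quotient in [C] because [C] is open; [cousin] joins
    these together. *)
Lemma mean_value_convex c (a b : R) C : a < b -> open C -> convex_set C ->
  (forall s, a <= s -> s <= b -> exists2 l, cder c s l & C l) ->
  C ((b - a)^-1 *: (c b - c a)).
Proof.
move=> ab oC cC der.
pose P x y := x < y -> C ((y - x)^-1 *: (c y - c x)).
suff: P a b by exact.
have comb x t y : x < t -> t < y -> C ((t - x)^-1 *: (c t - c x)) ->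
    C ((y - t)^-1 *: (c y - c t)) -> C ((y - x)^-1 *: (c y - c x)).
  move=> xt ty Cx Cy.
  have yx : 0 < y - x by lra.
  have -> : (y - x)^-1 *: (c y - c x) =
    ((t - x) / (y - x)) *: ((t - x)^-1 *: (c t - c x)) +
    (1 - (t - x) / (y - x)) *: ((y - t)^-1 *: (c y - c t)).
    have -> : 1 - (t - x) / (y - x) = (y - t) / (y - x).
      by field; rewrite gt_eqF.
    rewrite !scalerA !(mulrAC _ (y - x)^-1) !divff ?mul1r ?gt_eqF ?subr_gt0//.
    by rewrite -scalerDr; congr (_ *: _); rewrite [RHS]addrC addrA subrK.
  apply: convex_setP => //.
    by rewrite divr_ge0// ?subr_ge0 ltW// -subr_gt0.
  by rewrite ler_pdivrMr// mul1r; lra.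
apply: cousin; first exact: ltW.
  move=> x y z; rewrite le_eqVlt => /predU1P[->//|xy].
  rewrite le_eqVlt => /predU1P[->//|yz] /(_ xy) Pxy /(_ yz) Pyz _.
  exact: comb Pxy Pyz.
move=> t at_ tb; have [l cl Cl] := der t at_ tb.
have [d d0 dC] := cder_near cl (open_nbhs_nbhs (conj oC Cl)).
exists d => // x y ax xt ty yb yxd xy.
have right : t < y -> C ((y - t)^-1 *: (c y - c t)).
  move=> ty'; have := dC (y - t); rewrite (addrC t) subrK; apply.
    by rewrite ger0_norm; lra.
  by rewrite subr_eq0 gt_eqF.
have left : x < t -> C ((t - x)^-1 *: (c t - c x)).
  move=> xt'; have := dC (x - t); rewrite (addrC t) subrK.
  rewrite -[in X in _ -> _ -> X](opprB t x) invrN scaleNr -scalerN opprB; apply.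
    by rewrite ler0_norm; lra.
  by rewrite subr_eq0 lt_eqF.
move: xt; rewrite le_eqVlt => /predU1P[xt|xt].
  by rewrite xt; apply: right; rewrite -xt.
move: ty; rewrite le_eqVlt => /predU1P[ty|ty].
  by rewrite -ty; apply: left.
by apply: (comb _ t) => //; [exact: left|exact: right].
Qed.

Lemma cder_unique c t l l' : hausdorff_space E -> cder c t l -> cder c t l' ->
  l = l'.
Proof. by move=> hE cl cl'; apply: (cvg_unique hE cl cl'). Qed.

Lemma cder_continuous c t l : cder c t l -> {for t, continuous c}.
Proof.
move=> cl; rewrite /continuous_at.
have h0 := @cvg_id0 R.
have : (fun h : R => h *: (h^-1 *: (c (t + h) - c t)) + c t) @ 0^'
    --> 0 *: l + c t.
  by apply: tvs_cvgD; [exact: tvs_cvgZ|exact: cvg_cst].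
rewrite scale0r add0r => ct.
move=> O Ot; have [d /= d0 dO] := ct _ Ot.
exists d => //= s; rewrite -/(ball _ _ _) /= => sd.
have [->|st] := eqVneq s t; first exact: nbhs_singleton.
have := dO (s - t); rewrite /= sub0r normrN distrC => /(_ sd).
rewrite subr_eq0 st => /(_ isT).
by rewrite scalerA divff ?subr_eq0// scale1r (addrC t) !subrK.
Qed.

Lemma cder_near_eq c c' t l : (\forall s \near t, c s = c' s) ->
  cder c t l -> cder c' t l.
Proof.
move=> /= cc'; apply: cvg_trans; apply: near_eq_cvg.
have ct := nbhs_singleton cc'.
have := cvg_shift0 (t := t) cc'; rewrite /nbhs /= => H.
by near=> h; rewrite ct; congr (_ *: (_ - _)); near: h.
Unshelve. all: by end_near. Qed.

End CurveDerivative.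

(** * Strict differentiability and the chain rule *)

Section StrictDerivative.
Context {R : realType} {F E : tvsType R}.
Implicit Types (f : F -> E) (x v : F).

Lemma dderiveP f x v : dderivable f x v -> is_dderive f x v (dderive f x v).
Proof. by case=> l hl; exact: (xgetPex 0 (ex_intro _ l hl)). Qed.

Lemma is_dderive_unique f x v l l' : hausdorff_space E ->
  is_dderive f x v l -> is_dderive f x v l' -> l = l'.
Proof. by move=> hE hl hl'; exact: (cvg_unique hE hl hl'). Qed.

Lemma is_dderiveE f x v l : hausdorff_space E ->
  is_dderive f x v l -> dderive f x v = l.
Proof.
move=> hE hl; apply: (is_dderive_unique hE _ hl).
by apply: dderiveP; exists l.
Qed.

Lemma is_dderive_cder f x v l : is_dderive f x v l ->
  cder (fun t => f (x + t *: v)) 0 l.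
Proof.
rewrite /is_dderive /cder scale0r addr0.
by under [in X in _ -> X]eq_fun do rewrite add0r.
Qed.

Lemma cder_line f x v (s h : R) l : h != 0 ->
  is_dderive f (x + (s * h) *: v) v l ->
  cder (fun s => h^-1 *: f (x + (s * h) *: v)) s l.
Proof.
move=> h0 hl; rewrite /cder.
have rh := cvg_mulr_dnbhs0 h0.
have := cvg_comp _ _ rh hl; apply: cvg_trans; apply: near_eq_cvg.
near=> r.
have r0 : r != 0 by near: r; exact: nbhs_dnbhs_neq.
by rewrite /= mulrDl scalerDl addrA -scalerBr scalerA invfM.
Unshelve. all: by end_near. Qed.

(** Along the segment from [y t] to [y t + h t *: w t] all derivatives in the
    direction [w t] are close to that of the limit point, by joint continuity;
    the mean value theorem transfers this to the difference quotient.  Moving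
    base points give additivity in the direction, moving directions the chain
    rule. *)
Lemma strict_dderive f (U : set F) x0 v0 (T : Type) (G : set_system T)
    {FG : Filter G} (y w : T -> F) (h : T -> R) :
  open U -> U x0 -> (forall x v, U x -> dderivable f x v) ->
  {for (x0, v0), continuous (fun z : F * F => dderive f z.1 z.2)} ->
  y @ G --> x0 -> w @ G --> v0 -> h @ G --> (0 : R)^' ->
  (fun t => (h t)^-1 *: (f (y t + h t *: w t) - f (y t))) @ G
    --> dderive f x0 v0.
Proof.
move=> oU Ux0 df cf yx wv h0 O /nbhs_convex[C [oC cC CD CO]].
have [[N1 N2] /= [N1x N2v] N12] := cf _ (open_nbhs_nbhs (conj oC CD)).
have UN : nbhs x0 (U `&` N1) by apply: filterI => //; exact: open_nbhs_nbhs.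
have add0 : (fun z : (F * F) * R => z.1.1 + z.2 *: z.1.2) @ ((x0, v0), (0 : R))
    --> x0.
  rewrite -[X in _ --> X]addr0 -[X in _ + X](scale0r v0).
  apply: tvs_cvgD; first by apply: cvg_comp; exact: cvg_fst.
  apply: tvs_cvgZ; first exact: cvg_snd.
  by apply: cvg_comp; [exact: cvg_fst|exact: cvg_snd].
have [[A B] /= [Axv [d /= d0 Bd]] AB] := add0 _ UN.
have h0' : h @ G --> (0 : R) by apply: (cvg_trans h0); exact: cvg_within.
have yw : (fun t => (y t, w t)) @ G --> (x0, v0) by exact: cvg_pair.
have hn : \forall t \near G, h t != 0.
  have neq0 : \forall r \near (0 : R)^', r != 0 by exact: nbhs_dnbhs_neq.
  exact: (h0 _ neq0).
suff : \forall t \near G, O ((h t)^-1 *: (f (y t + h t *: w t) - f (y t))).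
  by [].
near=> t.
apply: CO.
have ht : h t != 0 by near: t; exact: hn.
have htd : `|h t| < d.
  near: t; move/cvgrPdist_lt: h0' => /(_ _ d0).
  by apply: filterS => t; rewrite sub0r normrN.
have Ayw : A (y t, w t) by near: t; exact: (yw _ Axv).
have N2w : N2 (w t) by near: t; exact: (wv _ N2v).
have := @mean_value_convex R E (fun s => (h t)^-1 *: f (y t + (s * h t) *: w t))
  0 1 C ltr01 oC cC.
rewrite subr0 invr1 scale1r mul1r mul0r scale0r addr0 -scalerBr; apply.
move=> s s0 s1.
have [|Uz N1z] := AB ((y t, w t), s * h t).
  split => //; apply: Bd; rewrite /= sub0r normrN normrM ger0_norm//.
  by apply: le_lt_trans htd; rewrite ler_piMl.
exists (dderive f (y t + (s * h t) *: w t) (w t)).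
  by apply: cder_line => //; apply: dderiveP; exact: df.
exact: (N12 (_, _)).
Unshelve. all: by end_near. Qed.

End StrictDerivative.

(** * Curves of class C^k *)

Section CurveRules.
Context {R : realType} {E : tvsType R}.
Implicit Types (c d : R -> E).

Lemma cderD c d t l m : cder c t l -> cder d t m ->
  cder (fun s => c s + d s) t (l + m).
Proof.
move=> cl dm; apply: cvg_trans (tvs_cvgD cl dm).
apply: near_eq_cvg; near=> h.
by rewrite -scalerDr opprD addrACA.
Unshelve. all: by end_near. Qed.

Lemma cder_cst (x : E) t : cder (fun=> x) t 0.
Proof.
rewrite /cder.
by under eq_fun do rewrite subrr scaler0; exact: cvg_cst.
Qed.

Lemma cder_sum (I : Type) (r : seq I) (c : I -> R -> E) t (l : I -> E) :
  (forall i, cder (c i) t (l i)) ->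
  cder (fun s => \sum_(i <- r) c i s) t (\sum_(i <- r) l i).
Proof.
move=> cl; elim: r => [|i r IH].
  by under eq_fun do rewrite big_nil; rewrite big_nil; exact: (cder_cst 0 t).
by under eq_fun do rewrite big_cons; rewrite big_cons; exact: (cderD (cl i) IH).
Qed.

Fixpoint Ccurve (k : nat) (c : R -> E) : Prop :=
  match k with
  | 0 => continuous c
  | k.+1 => exists2 c' : R -> E, (forall t, cder c t (c' t)) & Ccurve k c'
  end.

Definition smooth_curve c := forall k, Ccurve k c.

Lemma CcurveW k c : Ccurve k.+1 c -> Ccurve k c.
Proof.
elim: k c => [|k IH] c [c' cc' kc'].
  by move=> t; exact: cder_continuous (cc' t).
by exists c' => //; exact: IH.
Qed.

Lemma Ccurve_cst k (x : E) : Ccurve k (fun=> x).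
Proof.
elim: k x => [|k IH] x; first by move=> t; exact: cvg_cst.
by exists (fun=> 0) => // t; exact: (cder_cst x t).
Qed.

Lemma CcurveD k c d : Ccurve k c -> Ccurve k d -> Ccurve k (fun t => c t + d t).
Proof.
elim: k c d => [|k IH] c d.
  by move=> cc cd t; exact: (tvs_cvgD (cc t) (cd t)).
move=> [c' cc' kc'] [d' dd' kd']; exists (fun t => c' t + d' t); last exact: IH.
by move=> t; exact: (cderD (cc' t) (dd' t)).
Qed.

Lemma Ccurve_sum k (I : eqType) (r : seq I) (c : I -> R -> E) :
  (forall i, i \in r -> Ccurve k (c i)) ->
  Ccurve k (fun t => \sum_(i <- r) c i t).
Proof.
elim: r => [|i r IH] cr.
  by under eq_fun do rewrite big_nil; exact: Ccurve_cst.
under eq_fun do rewrite big_cons; apply: CcurveD.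
  by apply: cr; rewrite mem_head.
by apply: IH => j jr; apply: cr; rewrite inE jr orbT.
Qed.

End CurveRules.

Section ChainRule.
Context {R : realType} {F E : tvsType R}.

Definition C1_on (U : set F) (f : F -> E) :=
  (forall x v, U x -> dderivable f x v) /\
  (forall x v, U x ->
    {for (x, v), continuous (fun z : F * F => dderive f z.1 z.2)}).

(** The instance of [strict_dderive] whose directions are the difference
    quotients of [c]. *)
Lemma chain_rule (U : set F) (f : F -> E) (c : R -> F) t l :
  open U -> C1_on U f -> U (c t) -> cder c t l ->
  cder (fun s => f (c s)) t (dderive f (c t) l).
Proof.
move=> oU [df cf] Uct cl.
have id0 : (fun h : R => h) @ 0^' --> (0 : R)^' by exact: cvg_id.
have cst : (fun=> c t) @ (0 : R)^' --> c t by exact: cvg_cst.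
apply: cvg_trans (strict_dderive oU Uct df (cf _ l Uct) cst cl id0).
apply: near_eq_cvg; near=> h.
have h0 : h != 0 by near: h; exact: nbhs_dnbhs_neq.
by rewrite scalerA divff// scale1r (addrC (c t)) subrK.
Unshelve. all: by end_near. Qed.

Lemma is_dderive_near (U : set F) (f g : F -> E) x v l :
  open U -> U x -> (forall y, U y -> f y = g y) ->
  is_dderive f x v l -> is_dderive g x v l.
Proof.
move=> oU Ux fg H; apply: cvg_trans H; apply: near_eq_cvg.
have Uh : \forall h \near (0 : R)^', U (x + h *: v).
  exact: (@cvg_line0 R F x v _ (open_nbhs_nbhs (conj oU Ux))).
near=> h; rewrite !fg//; near: h; exact: Uh.
Unshelve. all: by end_near. Qed.

Lemma dderive0 (f : F -> E) x : hausdorff_space E -> dderive f x 0 = 0.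
Proof.
move=> hE; apply: is_dderiveE => //; rewrite /is_dderive.
by under eq_fun do rewrite scaler0 addr0 subrr scaler0; exact: cvg_cst.
Qed.

Lemma is_dderiveZ (f : F -> E) x v l (a : R) : is_dderive f x v l ->
  is_dderive f x (a *: v) (a *: l).
Proof.
move=> hl; have [->|a0] := eqVneq a 0.
  rewrite !scale0r /is_dderive.
  by under eq_fun do rewrite scaler0 addr0 subrr scaler0; exact: cvg_cst.
have rh := cvg_mulr_dnbhs0 a0.
have cst : (fun=> a) @ (0 : R)^' --> a by exact: cvg_cst.
apply: cvg_trans (tvs_cvgZ cst (cvg_comp _ _ rh hl)).
apply: near_eq_cvg; near=> r.
have r0 : r != 0 by near: r; exact: nbhs_dnbhs_neq.
by rewrite /= !scalerA invfM mulrCA divff// mulr1.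
Unshelve. all: by end_near. Qed.

(** The increment along [a *: v + w] is split at [x + h *: (a *: v)]; the second
    part has a moving base point, as [strict_dderive] permits. *)
Lemma dderive_lin (U : set F) (f : F -> E) x v w (a : R) : hausdorff_space E ->
  open U -> C1_on U f -> U x ->
  dderive f x (a *: v + w) = a *: dderive f x v + dderive f x w.
Proof.
move=> hE oU [df cf] Ux; apply: is_dderiveE => //.
have id0 : (fun h : R => h) @ 0^' --> (0 : R)^' by exact: cvg_id.
have line := @cvg_line0 R F x (a *: v).
have cst : (fun=> w) @ (0 : R)^' --> w by exact: cvg_cst.
have Dv := is_dderiveZ (a := a) (dderiveP (df x v Ux)).
apply: cvg_trans
  (tvs_cvgD Dv (strict_dderive oU Ux df (cf _ w Ux) line cst id0)).
apply: near_eq_cvg; near=> h.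
rewrite -scalerDr; congr (_ *: _); rewrite [in RHS]scalerDr.
rewrite [in RHS]addrA [LHS]addrC; set B := f (x + _ *: (a *: v)).
by rewrite addrA subrK.
Unshelve. all: by end_near. Qed.

End ChainRule.

(** * Iterated derivatives along curves *)

Section SeqConvergence.
Context {R : realType} {F : tvsType R} {T : Type} {G : set_system T}.
Context {FG : Filter G}.

Definition cvg_seq (W : T -> seq F) (V : seq F) :=
  (forall t, size (W t) = size V) /\
  (forall i, (fun t => nth 0 (W t) i) @ G --> nth 0 V i).

Lemma cvg_seq_cst V : cvg_seq (fun=> V) V.
Proof. by split => // i; exact: cvg_cst. Qed.

Lemma cvg_seq_cons w W x V : w @ G --> x -> cvg_seq W V ->
  cvg_seq (fun t => w t :: W t) (x :: V).
Proof. by move=> wx [sW cW]; split => [t|[|i]] //=; rewrite sW. Qed.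

Lemma cvg_seq_cat W1 V1 W2 V2 : cvg_seq W1 V1 -> cvg_seq W2 V2 ->
  cvg_seq (fun t => W1 t ++ W2 t) (V1 ++ V2).
Proof.
move=> [s1 c1] [s2 c2]; split => [t|i]; first by rewrite !size_cat s1 s2.
rewrite nth_cat; under eq_fun do rewrite nth_cat s1.
by case: ifP => _; [exact: c1|exact: c2].
Qed.

End SeqConvergence.

Section IteratedDerivatives.
Context {R : realType} {F E : tvsType R}.
Variables (U : set F) (f : F -> E).
Hypotheses (hE : hausdorff_space E) (oU : open U) (sf : smooth_on U f).
Notation D := (iter_dderive f).

Lemma iter_dderive_rcons vs v x : D (rcons vs v) x = dderive (D vs) x v.
Proof. by rewrite /iter_dderive foldl_rcons. Qed.

(** The joint continuity in the definition of C^k, with the tuples of directions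
    replaced by lists of moving vectors. *)
Lemma iter_dderive_cvg (T : Type) (G : set_system T) {FG : Filter G}
    (y : T -> F) x (W : T -> seq F) V : U x ->
  y @ G --> x -> cvg_seq (G := G) W V ->
  (fun t => D (W t) (y t)) @ G --> D V x.
Proof.
move=> Ux yx [sW cW].
have [_ /(_ (size V) (leqnn _)) cD] := sf (size V).
pose w t : {ptws 'I_(size V) -> F} := fun i => nth 0 (W t) i.
pose v : {ptws 'I_(size V) -> F} := fun i => nth 0 V i.
have oUT : open (U `*` [set: {ptws 'I_(size V) -> F}]).
  rewrite openE => -[x' v'] [/= Ux' _].
  exists (U, setT) => //=; split; first exact: open_nbhs_nbhs.
  exact: filterT.
move: cD; rewrite continuous_open_subspace// => /(_ (x, v)).
rewrite inE /= => /(_ (conj Ux I)) /=.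
have enumE (s : seq F) : size s = size V ->
    [seq nth 0 s (val i) | i <- enum 'I_(size V)] = s.
  move=> sV; rewrite -[RHS](mkseq_nth 0) /mkseq sV -val_enum_ord -map_comp.
  exact: eq_map.
have wv : w @ G --> v.
  apply/cvg_sup => i A [? /= [[B oB <-]] /= Bv /filterS]; apply.
  by apply: (cW i); exact: open_nbhs_nbhs.
have -> : D V x = D [seq v i | i <- enum 'I_(size V)] x by rewrite enumE.
have -> : (fun t => D (W t) (y t)) =
    (fun xv : F * {ptws 'I_(size V) -> F} =>
      D [seq xv.2 i | i <- enum 'I_(size V)] xv.1) \o (fun t => (y t, w t)).
  by apply/funext => t /=; rewrite enumE.
by move=> cD; exact: (cvg_comp _ _ (cvg_pair yx wv) cD).
Qed.

Lemma iter_dderive_derivable vs x v : U x -> dderivable (D vs) x v.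
Proof. by move=> Ux; have [+ _] := sf (size vs).+1; exact. Qed.

Lemma iter_dderive_C1 vs : C1_on U (D vs).
Proof.
split=> [x v Ux|x v Ux]; first exact: iter_dderive_derivable.
have DE y u : dderive (D vs) y u = D (vs ++ [:: u]) y.
  by rewrite cats1 iter_dderive_rcons.
have -> : (fun z : F * F => dderive (D vs) z.1 z.2) =
  (fun z => D (vs ++ [:: z.2]) z.1) by apply/funext => z.
apply: iter_dderive_cvg => //; first exact: cvg_fst.
apply: cvg_seq_cat; first exact: cvg_seq_cst.
by apply: cvg_seq_cons; [exact: cvg_snd|exact: cvg_seq_cst].
Qed.

(** In the last direction this is [dderive_lin]; in an earlier one, linearity
    passes to the further derivatives as these are limits. *)
Lemma iter_dderive_lin vs1 vs2 (a : R) v w x : U x ->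
  D (vs1 ++ (a *: v + w) :: vs2) x =
  a *: D (vs1 ++ v :: vs2) x + D (vs1 ++ w :: vs2) x.
Proof.
elim/last_ind: vs2 x => [|vs2 u IH] x Ux.
  rewrite !cats1 !iter_dderive_rcons.
  by apply: dderive_lin hE oU _ Ux; exact: iter_dderive_C1.
rewrite -!rcons_cons -!rcons_cat !iter_dderive_rcons.
apply: is_dderiveE => //.
apply: (@is_dderive_near _ _ _ U
  (fun y => a *: D (vs1 ++ v :: vs2) y + D (vs1 ++ w :: vs2) y)) => //.
  by move=> y Uy; rewrite IH.
have Dv := dderiveP (iter_dderive_derivable (vs1 ++ v :: vs2) u Ux).
have Dw := dderiveP (iter_dderive_derivable (vs1 ++ w :: vs2) u Ux).
have cst : (fun=> a) @ (0 : R)^' --> a by exact: cvg_cst.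
apply: cvg_trans (tvs_cvgD (tvs_cvgZ cst Dv) Dw).
apply: near_eq_cvg; near=> h.
by rewrite scalerA mulrC -scalerA -scalerDr scalerBr opprD addrACA.
Unshelve. all: by end_near. Qed.

Lemma iter_dderive_slot0 vs1 vs2 x : U x -> D (vs1 ++ 0 :: vs2) x = 0.
Proof.
move=> Ux; have := iter_dderive_lin vs1 vs2 (-1) 0 0 Ux.
by rewrite scaler0 addr0 scaleN1r addNr.
Qed.

(** The lists that differentiating a product of the factors [s] produces, [g]
    being the derivation. *)
Fixpoint slots (A : Type) (g : A -> A) (s : seq A) : seq (seq A) :=
  if s is x :: s' then (g x :: s') :: [seq x :: l | l <- slots g s'] else [::].

Notation evals cs t := [seq c t | c <- cs].

(** The Leibniz rule.  The slots are frozen at time [t] one after the other.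
    Freezing the slot [d] leaves an error term, linear in [d s - d t], which
    vanishes at [t]; therefore its derivative only requires the continuity of
    the other slots. *)
Lemma iter_dderive_cder (g : (R -> F) -> R -> F) t (cs : seq (R -> F)) c l vs :
  (forall s, U (c s)) -> cder c t l ->
  (forall d, d \in cs -> cder d t (g d t)) ->
  cder (fun s => D (vs ++ evals cs s) (c s)) t
    (D (vs ++ evals cs t ++ [:: l]) (c t) +
     \sum_(l <- slots g cs) D (vs ++ evals l t) (c t)).
Proof.
move=> Uc cl; have cc := cder_continuous cl.
have th := @cvg_shift0 R t.
have ct : (fun h : R => c (t + h)) @ 0^' --> c t.
  exact: (cvg_comp _ _ th cc).
elim: cs vs => [|d cs IH] vs dg.
  rewrite big_nil addr0 /= cats0 cats1 iter_dderive_rcons.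
  by apply: chain_rule oU _ _ cl => //; exact: iter_dderive_C1.
have dt := dg d (mem_head _ _).
have csg e : e \in cs -> cder e t (g e t).
  by move=> ecs; apply: dg; rewrite inE ecs orbT.
have {}IH := IH (rcons vs (d t)) csg.
rewrite /= big_cons big_map.
have slot : cder (fun s => D (vs ++ (d s - d t) :: evals cs s) (c s)) t
    (D (vs ++ (g d t :: evals cs t)) (c t)).
  rewrite /cder subrr iter_dderive_slot0//.
  have : (fun h : R => D (vs ++ h^-1 *: (d (t + h) - d t) :: evals cs (t + h))
      (c (t + h))) @ 0^' --> D (vs ++ g d t :: evals cs t) (c t).
    apply: iter_dderive_cvg => //.
    apply: cvg_seq_cat; first exact: cvg_seq_cst.
    apply: cvg_seq_cons; first exact: dt.
    elim: (cs) csg => [|e es IHe] esg; first exact: cvg_seq_cst.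
    apply: cvg_seq_cons; last first.
      by apply: IHe => e' e's; apply: esg; rewrite inE e's orbT.
    apply: (cvg_comp _ _ th).
    exact: (cder_continuous (esg e (mem_head _ _))).
  apply: cvg_trans; apply: near_eq_cvg; near=> h.
  rewrite subr0 -[X in D (vs ++ X :: _)]addr0 iter_dderive_lin//.
  by rewrite iter_dderive_slot0// addr0.
have := cderD slot IH.
congr cder.
  apply/funext => s; rewrite cat_rcons.
  have := iter_dderive_lin vs (evals cs s) 1 (d s - d t) (d t) (Uc s).
  by rewrite !scale1r subrK.
rewrite addrCA cat_rcons; congr (_ + (_ + _)).
by apply: eq_bigr => e _; rewrite cat_rcons.
Unshelve. all: by end_near. Qed.

Lemma mem_slots (A : eqType) (g : A -> A) (s l : seq A) (x : A) :
  l \in slots g s -> x \in l -> x \in s \/ exists2 y, y \in s & x = g y.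
Proof.
elim: s l => [|y s IH] l /=; first by rewrite in_nil.
rewrite in_cons => /orP[/eqP->|/mapP[l' l's ->]]; rewrite !in_cons.
  move=> /orP[/eqP->|->]; last by left; rewrite orbT.
  by right; exists y; rewrite ?mem_head.
move=> /orP[->|/(IH _ l's)[->|[z zs ->]]]; first by left.
  by left; rewrite orbT.
by right; exists z => //; rewrite in_cons zs orbT.
Qed.

(** By the Leibniz rule, the derivative of a curve of this form is a sum of
    curves of this form. *)
Lemma iter_dderive_Ccurve k c (cs : seq (R -> F)) :
  (forall t, U (c t)) -> Ccurve k c -> (forall d, d \in cs -> Ccurve k d) ->
  Ccurve k (fun t => D (evals cs t) (c t)).
Proof.
elim: k c cs => [|k IH] c cs Uc kc kcs.
  move=> t; apply: iter_dderive_cvg => //; first exact: kc.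
  elim: cs kcs => [|d cs IHcs] kcs; first exact: cvg_seq_cst.
  apply: cvg_seq_cons; first exact: (kcs d (mem_head _ _)).
  by apply: IHcs => e ecs; apply: kcs; rewrite inE ecs orbT.
have [c' cc' kc'] := kc.
pose g (d : R -> F) : R -> F :=
  xget (fun=> 0) [set d' | (forall t, cder d t (d' t)) /\ Ccurve k d'].
have gP d : d \in cs -> (forall t, cder d t (g d t)) /\ Ccurve k (g d).
  move=> /kcs[d' dd' kd'].
  have := xgetPex (fun=> 0) (ex_intro (fun d' =>
    (forall t, cder d t (d' t)) /\ Ccurve k d') d' (conj dd' kd')).
  by [].
exists (fun t => D (evals (rcons cs c') t) (c t) +
    \sum_(l <- slots g cs) D (evals l t) (c t)).
  move=> t; have := @iter_dderive_cder g t cs c (c' t) [::] Uc (cc' t).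
  by rewrite map_rcons -cats1; apply => d /gP[].
apply: CcurveD.
  apply: IH => //; first exact: CcurveW.
  by move=> d; rewrite mem_rcons inE => /orP[/eqP->//|/kcs/CcurveW].
apply: Ccurve_sum => l lcs; apply: IH => //; first exact: CcurveW.
move=> d dl; have [/kcs/CcurveW//|[e ecs ->]] := mem_slots lcs dl.
by have [] := gP e ecs.
Qed.

End IteratedDerivatives.

(** * Calculus of smooth curves *)

Section ScalarMultiples.
Context {R : realType} {E : tvsType R}.
Implicit Types (c : R -> E) (s : R -> R^o).

Lemma cderZ s c t (ds : R) l : cder s t (ds : R^o) -> cder c t l ->
  cder (fun t => s t *: c t) t (s t *: l + ds *: c t).
Proof.
move=> ss cl.
have ct := cvg_comp _ _ (@cvg_shift0 R t) (cder_continuous cl).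
have st : (fun=> s t : R) @ (0 : R)^' --> s t by exact: cvg_cst.
apply: cvg_trans (tvs_cvgD (tvs_cvgZ st cl) (tvs_cvgZ ss ct)).
apply: near_eq_cvg; near=> h.

rewrite scalerA (mulrC (s t)) -scalerA -scalerA -scalerDr; congr (_ *: _).
by rewrite scalerBr scalerBl [LHS]addrC addrA subrK.
Unshelve. all: by end_near. Qed.

Lemma CcurveZ k s c : Ccurve k s -> Ccurve k c ->
  Ccurve k (fun t => s t *: c t).
Proof.
elim: k s c => [|k IH] s c.
  by move=> cs cc t; exact: (tvs_cvgZ (cs t) (cc t)).
move=> ks kc; have [[s' ss' ks'] [c' cc' kc']] := (ks, kc).
exists (fun t => s t *: c' t + s' t *: c t).
  by move=> t; exact: (cderZ (ss' t) (cc' t)).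
by apply: CcurveD; apply: IH => //; exact: CcurveW.
Qed.

Lemma cderV s t (ds : R) : (forall t, s t != 0) -> cder s t (ds : R^o) ->
  cder (fun t => (s t)^-1 : R^o) t (- (ds * (s t)^-1 * (s t)^-1) : R^o).
Proof.
move=> s0 ss.
have st : (fun h => s (t + h) : R) @ (0 : R)^' --> (s t : R).
  exact: (cvg_comp _ _ (@cvg_shift0 R t) (cder_continuous ss)).
have stV : (fun h => (s (t + h))^-1 : R) @ (0 : R)^' --> ((s t)^-1 : R).
  exact: cvgV.
have cst : (fun=> (s t)^-1 : R) @ (0 : R)^' --> ((s t)^-1 : R).
  exact: cvg_cst.
apply: cvg_trans (cvgN (cvgM (cvgM (ss : _ --> (ds : R)) stV) cst)).
apply: near_eq_cvg; near=> h.
have h0 : h != 0 by near: h; exact: nbhs_dnbhs_neq.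
rewrite [LHS](_ : _ =
  - (h^-1 * (s (t + h) - s t) * (s (t + h))^-1 * (s t)^-1))//.
rewrite /GRing.scale /=; field.
by rewrite h0 !s0.
Unshelve. all: by end_near. Qed.

End ScalarMultiples.

Section InverseRule.
Context {R : realType}.
Implicit Types (s : R -> R^o).

Lemma CcurveV k s : (forall t, s t != 0) -> Ccurve k s ->
  Ccurve k (fun t => (s t)^-1 : R^o).
Proof.
move=> s0; elim: k => [|k IH].
  by move=> cs t; apply: cvgV => //; exact: cs.
move=> ks; have [s' ss' ks'] := ks.
exists (fun t => (-1 : R) *: (s' t *: ((s t)^-1 *: ((s t)^-1 : R^o)))).
  move=> t; have := cderV s0 (ss' t).
  by rewrite /GRing.scale /= mulN1r mulrA.
have sV := IH (CcurveW ks).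
apply: (CcurveZ (s := fun=> -1)); first exact: Ccurve_cst.
by do 2?apply: CcurveZ.
Qed.

End InverseRule.

Section SmoothCurves.
Context {R : realType} {E : tvsType R}.
Implicit Types (c : R -> E) (s : R -> R^o).

Lemma cder_affine c (a b t : R) l : cder c (a * t + b) l ->
  cder (fun u => c (a * u + b)) t (a *: l).
Proof.
move=> cl; have [->|a0] := eqVneq a 0.
  rewrite scale0r; under eq_fun do rewrite mul0r add0r.
  exact: (cder_cst (c b) t).
have rh := cvg_mulr_dnbhs0 a0.
have cst : (fun=> a) @ (0 : R)^' --> a by exact: cvg_cst.
apply: cvg_trans (tvs_cvgZ cst (cvg_comp _ _ rh cl)).
apply: near_eq_cvg; near=> r.
have r0 : r != 0 by near: r; exact: nbhs_dnbhs_neq.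
rewrite /= !scalerA invfM mulrCA divff// mulr1.
by rewrite mulrDr addrAC (mulrC r).
Unshelve. all: by end_near. Qed.

Lemma Ccurve_affine k c (a b : R) : Ccurve k c ->
  Ccurve k (fun u => c (a * u + b)).
Proof.
elim: k c => [|k IH] c.
  move=> cc t.
  apply: (continuous_comp (f := fun u => a * u + b)); last exact: cc.
  apply: cvgD; last exact: cvg_cst.
  by apply: cvgM; [exact: cvg_cst|exact: cvg_id].
move=> [c' cc' kc']; exists (fun u => a *: c' (a * u + b)).
  by move=> t; exact: (cder_affine (cc' _)).
by apply: (CcurveZ (s := fun=> a)); [exact: Ccurve_cst|exact: IH].
Qed.

Lemma smooth_curve_seq (hE : hausdorff_space E) c : smooth_curve c ->
  exists2 D : nat -> R -> E, D 0%N = c & forall k t, cder (D k) t (D k.+1 t).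
Proof.
move=> sc.
pose dc c := fun t => xget 0 [set l | cder c t l] : E.
have dcE c1 c2 : (forall t, cder c1 t (c2 t)) -> dc c1 = c2.
  move=> c12; apply/funext => t; apply: (cder_unique hE _ (c12 t)).
  exact: (xgetPex 0 (ex_intro _ _ (c12 t))).
have dcP c1 : smooth_curve c1 ->
    (forall t, cder c1 t (dc c1 t)) /\ smooth_curve (dc c1).
  move=> sc1; split; first by have [c2 c12 _] := sc1 1%N; rewrite (dcE _ _ c12).
  by move=> k; have [c2 c12 kc2] := sc1 k.+1; rewrite (dcE _ _ c12).
have sD k : smooth_curve (iter k dc c) by elim: k => //= k /dcP[].
exists (fun k => iter k dc c) => // k t /=.
by have [] := dcP _ (sD k).
Qed.

Lemma seq_smooth_curve (D : nat -> R -> E) :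
  (forall k t, cder (D k) t (D k.+1 t)) -> smooth_curve (D 0%N).
Proof.
move=> DD k; elim: k 0%N => [|k IH] j.
  by move=> t; exact: cder_continuous (DD j t).
by exists (D j.+1).
Qed.

Lemma hausdorff_eq (x y : E) : hausdorff_space E ->
  (forall O, nbhs x O -> O y) -> x = y.
Proof.
move=> hE xy; apply: hE => A B Ax By; exists y.
by split; [exact: xy|exact: nbhs_singleton].
Qed.

(** Serves to show that a derivative vanishes at the boundary of a closed
    interval on which the curve is constant. *)
Lemma cder_eq0 c t l : hausdorff_space E -> cder c t l ->
  (forall d : R, 0 < d -> exists h, [/\ `|h| < d, h != 0 & c (t + h) = c t]) ->
  l = 0.
Proof.
move=> hE cl ch; apply: hausdorff_eq => // O Ol.
have [d d0 dO] := cder_near cl Ol.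
have [h [hd h0 hc]] := ch d d0.
by have := dO h hd h0; rewrite hc subrr scaler0.
Qed.

Lemma cder_pair (F : tvsType R) c (d : R -> F) t l m : cder c t l ->
  cder d t m -> cder (fun u => (c u, d u)) t ((l, m) : (E * F)%type).
Proof. by move=> cl dm; apply: cvg_pair. Qed.

Lemma Ccurve_pair (F : tvsType R) k c (d : R -> F) : Ccurve k c ->
  Ccurve k d -> Ccurve k (fun u => (c u, d u) : (E * F)%type).
Proof.
elim: k c d => [|k IH] c d.
  by move=> cc cd t; apply: cvg_pair; [exact: cc|exact: cd].
move=> [c' cc' kc'] [d' dd' kd'].
exists (fun u => (c' u, d' u)); last exact: IH.
by move=> t; exact: cder_pair.
Qed.

End SmoothCurves.

(** * A smooth step function *)

Section FlatFunctions.
Context {R : realType}.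

Lemma is_derive_cder (f : R -> R) (t l : R) : is_derive t 1 f l ->
  cder (f : R -> R^o) t (l : R^o).
Proof.
move=> fl; have := @ex_derive _ _ _ _ _ _ _ fl; rewrite /derivable.
have := @derive_val _ _ _ _ _ _ _ fl; rewrite /derive => <-.
apply: cvg_trans; apply: near_eq_cvg; near=> h.
by rewrite /= /GRing.scale /= mulr1 (addrC t).
Unshelve. all: by end_near. Qed.

(** These functions include the standard flat function exp(-1/x), for [q = 1],
    and form a class that is stable under differentiation. *)
Definition flat (q : {poly R}) (x : R) : R^o :=
  if 0 < x then q.[x^-1] * expR (- x^-1) else 0.

(** From exp y = (exp (y / n))^n >= (y / n)^n. *)
Lemma expR_pow_bound n (y : R) : 0 < y -> y ^+ n * expR (- y) <= n%:R ^+ n.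
Proof.
move=> y0; rewrite expRN ler_pdivrMr ?expR_gt0//.
have [->|n0] := eqVneq n 0%N.
  by rewrite !expr0 mul1r ltW// expR_gt1.
have n0' : 0 < n%:R :> R by rewrite ltr0n lt0n.
have -> : expR y = expR (y / n%:R) ^+ n.
  by rewrite -expRM_natr divfK// gt_eqF.
rewrite -exprMn; apply: lerXn2r.
- by rewrite nnegrE ltW.
- by rewrite nnegrE mulr_ge0// ?expR_ge0// ltW.
rewrite -ler_pdivrMl// mulrC.
by apply: (le_trans _ (expR_ge1Dx _)); rewrite lerDr.
Qed.

Lemma flat_bound q : exists2 C : R, 0 <= C &
  forall x, `|flat q x : R| <= C * `|x|.
Proof.
exists (\sum_(i < size q) `|q`_i| * i.+1%:R ^+ i.+1).
  by apply: sumr_ge0 => i _; rewrite mulr_ge0.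
move=> x; rewrite /flat; case: ltP => [x0|_]; last first.
  by rewrite normr0 mulr_ge0// sumr_ge0// => i _; rewrite mulr_ge0.
rewrite (gtr0_norm x0) -ler_pdivrMr// normrM (gtr0_norm (expR_gt0 _)).
rewrite horner_coef -mulrA.
apply: (@le_trans _ _ ((\sum_(i < size q) `|q`_i| * x^-1 ^+ i) *
    (expR (- x^-1) / x))).
  apply: ler_wpM2r; first by rewrite mulr_ge0 ?expR_ge0// invr_ge0 ltW.
  apply: le_trans (ler_norm_sum _ _ _) _; apply: ler_sum => i _.
  by rewrite normrM [X in _ * X]ger0_norm// exprn_ge0// invr_ge0 ltW.
rewrite mulr_suml; apply: ler_sum => i _; rewrite -mulrA ler_wpM2l//.
rewrite (mulrC (expR _)) mulrA -exprSr; apply: expR_pow_bound.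
by rewrite invr_gt0.
Qed.

Lemma cder_flat q t : cder (flat q) t (flat ('X^2 * (q - q^`())) t).
Proof.
have [t0|t0|->] := ltgtP t 0.
- rewrite /flat ltNge (ltW t0) /=.
  apply: (cder_near_eq _ (cder_cst (0 : R^o) t)).
  near=> s; rewrite ltNge ltW//; near: s.
  exact: lt_nbhsl.
- have -> : flat ('X^2 * (q - q^`())) t =
      (q^`().[t^-1] * (- t ^- 2 * 1)) * expR (- t^-1) +
      q.[t^-1] * (expR (- t^-1) * - (- t ^- 2 * 1)).
    rewrite /flat t0 !hornerE /= exprVn; set e := expR _; ring.
  apply: (@cder_near_eq _ _ (fun s => q.[s^-1] * expR (- s^-1) : R^o)).
    near=> s; rewrite /flat ifT//; near: s; exact: lt_nbhsr.
  have tn0 : t != 0 by rewrite gt_eqF.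
  apply: is_derive_cder.
  have dV : is_derive t 1 (fun s : R => s^-1) (- t ^- 2 * 1).
    exact: (is_deriveV tn0 (is_derive_id _ _)).
  have dq := is_derive1_comp (is_derive_poly q t^-1) dV.
  have de := @is_derive1_comp _ expR (fun s : R => - s^-1) _ _ _
    (is_derive_expR (- t^-1)) (is_deriveN dV).
  apply: (is_derive_eq (is_deriveM dq de)).
  by rewrite /GRing.scale /= addrC (mulrC (expR _)).
- rewrite {2}/flat ltxx /cder.
  have [C C0 CX] := flat_bound ('X * q).
  have fl0 : flat q 0 = 0 by rewrite /flat ltxx.
  apply: (@cvg_trans _ ((flat ('X * q) : R -> R) @ 0^')).
    apply: near_eq_cvg; near=> h.
    have h0 : h != 0 by near: h; exact: nbhs_dnbhs_neq.
    rewrite fl0 subr0 add0r /flat /GRing.scale /=; case: ifP => hp.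
      by rewrite hornerM hornerX -[LHS]mulrA.
    by rewrite mulr0.
  have C1 : 0 < C + 1 by rewrite ltr_wpDl.
  apply/cvgrPdist_le => /= e e0; near=> h.
  rewrite sub0r normrN (le_trans (CX h))//.
  apply: (@le_trans _ _ ((C + 1) * `|h|)); first by rewrite ler_wpM2r// lerDl.
  rewrite -ler_pdivlMl// mulrC.
  near: h; apply: dnbhs0_le.
  by rewrite divr_gt0.
Unshelve. all: by end_near. Qed.

Lemma smooth_flat q : smooth_curve (flat q).
Proof.
pose D k := iter k (fun q : {poly R} => 'X^2 * (q - q^`())) q.
apply: (@seq_smooth_curve R R^o (fun k => flat (D k))) => k t.
exact: cder_flat.
Qed.

Lemma flat1_ge0 x : 0 <= (flat 1 x : R).
Proof. by rewrite /flat; case: ifP => // _; rewrite hornerC mul1r expR_ge0. Qed.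

Lemma flat1_gt0 x : 0 < x -> 0 < (flat 1 x : R).
Proof. by move=> x0; rewrite /flat x0 hornerC mul1r expR_gt0. Qed.

Lemma flat1_eq0 x : x <= 0 -> flat 1 x = 0.
Proof. by rewrite /flat; case: ltP. Qed.

Definition step (x : R) : R^o :=
  (flat 1 x : R) / ((flat 1 x : R) + (flat 1 (1 - x) : R)).

Lemma step_den_gt0 x : 0 < (flat 1 x : R) + (flat 1 (1 - x) : R).
Proof.
have [x0|x0] := ltP 0 x; first by rewrite ltr_wpDr ?flat1_ge0// flat1_gt0.
by rewrite ltr_wpDl ?flat1_ge0// flat1_gt0// subr_gt0 (le_lt_trans x0).
Qed.

Lemma smooth_step : smooth_curve step.
Proof.
move=> k; rewrite /step.
under eq_fun do rewrite -[_ / _]/(_ *: (_ : R^o)).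
apply: CcurveZ; first exact: smooth_flat.
apply: CcurveV; first by move=> t; rewrite gt_eqF// step_den_gt0.
apply: CcurveD; first exact: smooth_flat.
have -> : (fun t => flat 1 (1 - t)) = (fun t => flat 1 ((-1) * t + 1)).
  by apply/funext => t; rewrite mulN1r addrC.
by apply: Ccurve_affine; exact: smooth_flat.
Qed.

Lemma step_le0 x : x <= 0 -> step x = 0.
Proof. by move=> x0; rewrite /step flat1_eq0// mul0r. Qed.

Lemma step_ge1 x : 1 <= x -> step x = 1.
Proof.
move=> x1; rewrite /step (@flat1_eq0 (1 - x)) ?subr_le0// addr0 divff//.
by rewrite gt_eqF// flat1_gt0// (lt_le_trans ltr01).
Qed.

Lemma step_ge0 x : 0 <= (step x : R).
Proof. by rewrite /step mulr_ge0 ?flat1_ge0// invr_ge0 ltW// step_den_gt0. Qed.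

Lemma step_le1 x : (step x : R) <= 1.
Proof.
rewrite /step ler_pdivrMr ?step_den_gt0// mul1r.
by rewrite lerDl flat1_ge0.
Qed.

End FlatFunctions.

(** * Seminorms *)

Section Seminorms.
Context {R : realType} {E : tvsType R}.
Implicit Types (p : E -> R) (C : set E).

Lemma seminorm0 p : continuous_seminorm p -> p 0 = 0.
Proof. by case=> _ pZ _; rewrite -(scale0r 0) pZ normr0 mul0r. Qed.

Lemma seminorm_ge0 p x : continuous_seminorm p -> 0 <= p x.
Proof.
move=> ps; have [pD pZ _] := ps.
have := pD x (- x); rewrite subrr (seminorm0 ps) -scaleN1r pZ normrN1 mul1r.
lra.
Qed.

Lemma seminormZ (c : R) p : 0 <= c -> continuous_seminorm p ->
  continuous_seminorm (fun x => c * p x).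
Proof.
move=> c0 [pD pZ pc]; split => [x y|a x|x].
- by rewrite -mulrDr ler_wpM2l.
- by rewrite pZ mulrCA.
- by apply: cvgM; [exact: cvg_cst|exact: pc].
Qed.

Definition gauge_set C x := [set r : R | 0 < r /\ C (r^-1 *: x)].
Definition gauge C x := inf (gauge_set C x).

Lemma gauge_seminorm C : nbhs 0 C -> convex_set C ->
  (forall x, C x -> C (- x)) ->
  continuous_seminorm (gauge C) /\ (forall x, gauge C x < 1 -> C x).
Proof.
move=> C0 cC CN.
have C00 := nbhs_singleton C0.
have lb x : has_lbound (gauge_set C x) by exists 0 => r [/ltW].
have absorb x : exists r, gauge_set C x r.
  have : (fun r : R => r *: x) @ (0 : R) --> 0 *: x.
    by apply: tvs_cvgZ; [exact: cvg_id|exact: cvg_cst].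
  rewrite scale0r => /(_ _ C0) [d /= d0 dC].
  exists (2 / d); split; first by rewrite divr_gt0.
  apply: dC; rewrite /= sub0r normrN ger0_norm ?invr_ge0 ?divr_ge0 ?ltW//.
  by rewrite invf_div; lra.
have hinf x : has_inf (gauge_set C x) by split; [exact: absorb|].
have gle x r : 0 < r -> C (r^-1 *: x) -> gauge C x <= r.
  by move=> r0 Cr; apply: ge_inf.
have shrink r x : 0 <= r -> r <= 1 -> C x -> C (r *: x).
  move=> r0 r1 Cx; rewrite -[r *: x]addr0 -(scaler0 _ (1 - r)).
  exact: convex_setP.
have approx x e : 0 < e ->
    exists r, [/\ 0 < r, C (r^-1 *: x) & r < gauge C x + e].
  by move=> e0; have [r [r0 Cr] re] := inf_adherent e0 (hinf x); exists r.
have gauge_ge0 x : 0 <= gauge C x.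
  by apply: lb_le_inf => [|r [/ltW]]; [exact: absorb|].
have gaugeD x y : gauge C (x + y) <= gauge C x + gauge C y.
  apply/ler_addgt0Pl => e e0.
  have e20 : 0 < e / 2 by rewrite divr_gt0.
  have [r [r0 Cr re]] := approx x _ e20.
  have [s [s0 Cs se]] := approx y _ e20.
  have rs0 : 0 < r + s by rewrite addr_gt0.
  apply: (@le_trans _ _ (r + s)); last by lra.
  apply: gle => //.
  have -> : (r + s)^-1 *: (x + y) =
      (r / (r + s)) *: (r^-1 *: x) + (1 - r / (r + s)) *: (s^-1 *: y).
    have -> : 1 - r / (r + s) = s / (r + s) by field; rewrite gt_eqF.
    by rewrite !scalerA !(mulrAC _ (r + s)^-1) !divff ?gt_eqF// !mul1r scalerDr.
  apply: convex_setP => //; first by rewrite divr_ge0// ltW.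
  by rewrite ler_pdivrMr// mul1r lerDl ltW.
have gaugeZle (a : R) x : a != 0 -> gauge C (a *: x) <= `|a| * gauge C x.
  move=> a0; have na0 : 0 < `|a| by rewrite normr_gt0.
  rewrite -ler_pdivrMl//; apply: lb_le_inf; first exact: absorb.
  move=> r [r0 Cr]; rewrite ler_pdivrMl//; apply: gle; first exact: mulr_gt0.
  rewrite scalerA invfM mulrAC.
  have [a1|a1] := ger0P a.
    by rewrite mulVf// mul1r.
  by rewrite invrN mulNr mulVf// mulN1r scaleNr; exact: CN.
have gaugeZ (a : R) x : gauge C (a *: x) = `|a| * gauge C x.
  have [->|a0] := eqVneq a 0.
    rewrite scale0r normr0 mul0r; apply/eqP; rewrite eq_le gauge_ge0 andbT.
    apply/ler_addgt0Pl => e e0; rewrite addr0; apply: gle => //.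
    by rewrite scaler0.
  apply/eqP; rewrite eq_le gaugeZle//=.
  have := gaugeZle a^-1 (a *: x); rewrite scalerA mulVf// scale1r invr_eq0.
  by move=> /(_ a0); rewrite normfV ler_pdivlMl// normr_gt0.
have gaugeB x y : gauge C x - gauge C y <= gauge C (x - y).
  by rewrite lerBlDr; have := gaugeD (x - y) y; rewrite subrK.
split; last first.
  move=> x x1; have [|r [r0 Cr]] := approx x (1 - gauge C x).
    by rewrite subr_gt0.
  rewrite addrC subrK => r1.
  rewrite -[x]scale1r -(mulfV (lt0r_neq0 r0)) -scalerA.
  by apply: shrink => //; exact: ltW.
split => // x; apply/cvgrPdist_le => e e0.
have CE : nbhs 0 ( *:%R e @` C) by apply: nbhs0Z => //; rewrite gt_eqF.
have xy : (fun y => x - y) @ x --> 0.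
  rewrite -(subrr x); apply: tvs_cvgB; [exact: cvg_cst|exact: cvg_id].
near=> y.
have [c Cc ec] : ( *:%R e @` C) (x - y) by near: y; exact: (xy _ CE).
have gxy : gauge C (x - y) <= e.
  by apply: gle => //; rewrite -ec scalerA mulVf ?scale1r// gt_eqF.
rewrite ler_norml; apply/andP; split.
  rewrite lerNl opprB; apply: le_trans (gaugeB y x) _.
  by rewrite -opprB -scaleN1r gaugeZ normrN1 mul1r.
exact: le_trans (gaugeB x y) _.
Unshelve. all: by end_near. Qed.

(** The gauge of a symmetric convex neighbourhood of 0 is a continuous seminorm,
    so the seminorms determine the topology. *)
Lemma nbhs0_seminorm (O : set E) : nbhs 0 O ->
  exists2 p, continuous_seminorm p & forall x, p x < 1 -> O x.
Proof.
move=> /nbhs_convex[C [oC cC C0 CO]].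
pose S := [set x | C x /\ C (- x)].
have S0 : nbhs 0 S.
  apply: filterI; first exact: open_nbhs_nbhs.
  have : (fun x : E => - x) @ (0 : E) --> - (0 : E).
    by apply: tvs_cvgN; exact: cvg_id.
  by apply; rewrite oppr0; exact: open_nbhs_nbhs.
have cS : convex_set S.
  move=> x y k; rewrite !inE => -[Cx CNx] [Cy CNy]; split.
    by apply/set_mem; apply: cC; exact/mem_set.
  have := cC (- x) (- y) k (mem_set CNx) (mem_set CNy); rewrite inE.
  by rewrite /conv /= !scalerN -opprD.
have SN x : S x -> S (- x) by move=> [Cx CNx]; split; rewrite ?opprK.
have [gs gS] := gauge_seminorm S0 cS SN.
by exists (gauge S) => // x /gS[Cx _]; exact: CO.
Qed.

Lemma seminorms_cvg0 (T : Type) (G : set_system T) {FG : Filter G}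
    (f : T -> E) :
  (forall p, continuous_seminorm p -> \forall t \near G, p (f t) < 1) ->
  f @ G --> (0 : E).
Proof.
move=> fp O /nbhs0_seminorm[p ps pO].
by have := fp p ps; rewrite nbhs_filterE; apply: filterS => t /pO.
Qed.

End Seminorms.

(** * Smooth curves from rapidly decreasing sequences *)

Lemma hausdorff_line (R : realType) : hausdorff_space (R^o : tvsType R).
Proof. exact: (@norm_hausdorff _ R^o). Qed.

Section DyadicTimes.
Context {R : realType}.

(** Time is divided into the blocks between [dtime n] and [dtime n.+1], and
    [dparam n] is the affine map that sends the [n]-th block onto [0, 1]. *)
Definition dtime (n : nat) : R := 1 - 2 ^- n.
Definition dparam (n : nat) (t : R) : R := 2 ^+ n.+1 * t + (2 - 2 ^+ n.+1).

Lemma dtime_lt1 n : dtime n < 1.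
Proof. by rewrite /dtime ltrBlDr ltrDl invr_gt0 exprn_gt0. Qed.

Lemma dtime0 : dtime 0 = 0.
Proof. by rewrite /dtime expr0 invr1 subrr. Qed.

Lemma dtime_le m n : (m <= n)%N -> dtime m <= dtime n.
Proof.
move=> mn; rewrite /dtime lerD2l lerN2 lef_pV2 ?posrE ?exprn_gt0//.
by rewrite ler_weXn2l// ler1n.
Qed.

Lemma dparamE n t : dparam n t = 2 ^+ n.+1 * (t - dtime n).
Proof.
have x0 : 2 ^+ n != 0 :> R by rewrite expf_neq0// pnatr_eq0.
by rewrite /dparam /dtime exprS; set x := 2 ^+ n in x0 *; field.
Qed.

Lemma dparamE1 n t : dparam n t = 2 ^+ n.+1 * (t - dtime n.+1) + 1.
Proof.
have x0 : 2 ^+ n.+1 != 0 :> R by rewrite expf_neq0// pnatr_eq0.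
by rewrite /dparam /dtime; set x := 2 ^+ n.+1 in x0 *; field.
Qed.

Lemma dparam_le0 n t : t <= dtime n -> dparam n t <= 0.
Proof. by move=> tn; rewrite dparamE pmulr_rle0 ?exprn_gt0// subr_le0. Qed.

Lemma dparam_ge1 n t : dtime n.+1 <= t -> 1 <= dparam n t.
Proof.
by move=> tn; rewrite dparamE1 lerDr pmulr_rge0 ?exprn_gt0// subr_ge0.
Qed.

Lemma dparam0 n : dparam n (dtime n) = 0.
Proof. by rewrite dparamE subrr mulr0. Qed.

Lemma dparam1 n : dparam n (dtime n.+1) = 1.
Proof. by rewrite dparamE1 subrr mulr0 add0r. Qed.

Lemma dtime_ex t : t < 1 -> exists n, t < dtime n.
Proof.
move=> t1; have t10 : 0 < (1 - t)^-1 by rewrite invr_gt0 subr_gt0.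
exists (Num.bound (1 - t)^-1); rewrite /dtime ltrBrDl -ltrBrDr.
rewrite -[ltRHS]invrK ltf_pV2 ?posrE ?exprn_gt0//.
apply: lt_le_trans (archi_boundP (ltW t10)) _.
by rewrite -natrX ler_nat ltnW// ltn_expl.
Qed.

Lemma dtime_block t : 0 <= t -> t < 1 ->
  exists n, dtime n <= t /\ t < dtime n.+1.
Proof.
move=> t0 t1; case: (ex_minnP (dtime_ex t1)) => -[|n] tn nmin.
  by move: tn; rewrite dtime0 ltNge t0.
exists n; split => //; rewrite leNgt; apply/negP => /nmin.
by rewrite ltnn.
Qed.

End DyadicTimes.

Section RapidSeries.
Context {R : realType} {E : tvsType R}.

(** This is the decay that absorbs the powers of [2 ^+ n] by which derivatives
    of functions of [dparam n t] grow. *)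
Definition rapid (z : nat -> E) := forall p, continuous_seminorm p ->
  forall k, \forall n \near \oo, p (z n) * 2 ^+ (k * n) <= 1.

Lemma rapid_scale z : rapid z -> rapid (fun n => 2 ^+ n.+1 *: z n).
Proof.
move=> rz p ps k.
have p2 : continuous_seminorm (fun x => 2 * p x) by exact: seminormZ.
have [_ pZ _] := ps.
near=> n; rewrite pZ ger0_norm ?exprn_ge0//.
have : 2 * p (z n) * 2 ^+ (k.+1 * n) <= 1 by near: n; exact: (rz _ p2 k.+1).
by rewrite mulSn exprD exprS; lra.
Unshelve. all: by end_near. Qed.

Lemma bounded_support (f : R -> R) : continuous f ->
  (forall u : R, u <= 0 -> f u = 0) -> (forall u, 1 <= u -> f u = 0) ->
  exists2 M : R, 0 <= M & forall u, `|f u| <= M.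
Proof.
move=> cf f0 f1.
have [|c _ cmax] := @EVT_max R (fun u => `|f u|) 0 1 ler01.
  apply: continuous_subspaceT => u.
  by apply: (continuous_comp (cf u)); exact: norm_continuous.
exists `|f c| => // u.
have [u0|u0] := leP u 0; first by rewrite f0// normr0.
have [u1|u1] := leP 1 u; first by rewrite f1// normr0.
by apply: cmax; rewrite in_itv /= !ltW.
Qed.

Variables (D : nat -> R -> R^o) (z : nat -> E).
Hypotheses (DD : forall k u, cder (D k) u (D k.+1 u)).
Hypotheses (D0 : forall u : R, u <= 0 -> D 0%N u = 0).
Hypotheses (D1 : forall u, 1 <= u -> D 0%N u = 0).
Hypothesis rz : rapid z.

Lemma profile_le0 k u : u <= 0 -> D k u = 0.
Proof.
elim: k u => [|k IH] u u0; first exact: D0.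
apply: (cder_eq0 (@hausdorff_line R) (@DD k u)) => d d0.
exists (- (d / 2)); split.
- by rewrite normrN ger0_norm; lra.
- by rewrite oppr_eq0 gt_eqF// divr_gt0.
- by rewrite !IH//; lra.
Qed.

Lemma profile_ge1 k u : 1 <= u -> D k u = 0.
Proof.
elim: k u => [|k IH] u u1; first exact: D1.
apply: (cder_eq0 (@hausdorff_line R) (@DD k u)) => d d0.
exists (d / 2); split.
- by rewrite ger0_norm; lra.
- by rewrite gt_eqF// divr_gt0.
- by rewrite !IH//; lra.
Qed.

(** The [k]-th derivative of the function D 0 (dparam n t) z_n of [t]. *)
Definition term k n t : E := (2 ^+ n.+1) ^+ k *: (D k (dparam n t) *: z n).
Definition psum k N t : E := \sum_(n < N) term k n t.

Lemma term_le k n t : t <= dtime n -> term k n t = 0.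
Proof.
by move=> tn; rewrite /term profile_le0 ?dparam_le0// scale0r scaler0.
Qed.

Lemma term_ge k n t : dtime n.+1 <= t -> term k n t = 0.
Proof.
by move=> tn; rewrite /term profile_ge1 ?dparam_ge1// scale0r scaler0.
Qed.

Lemma cder_term k n t : cder (term k n) t (term k.+1 n t).
Proof.
have Dn := cder_affine (@DD k (dparam n t)).
have cst (x : E) := cder_cst x t.
have cstR (x : R^o) := cder_cst x t.
have := cderZ (cstR ((2 ^+ n.+1) ^+ k)) (cderZ Dn (cst (z n))).
rewrite /term scaler0 scale0r add0r addr0.
rewrite [(2 ^+ n.+1) ^+ k.+1]exprSr.
by rewrite -[in X in _ -> X](scalerA _ (2 ^+ n.+1)) (scalerA (2 ^+ n.+1)).
Qed.

Lemma cder_psum k N t : cder (psum k N) t (psum k.+1 N t).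
Proof. by apply: cder_sum => i; exact: cder_term. Qed.

Lemma psum_stable k N M t : t <= dtime N -> (N <= M)%N ->
  psum k M t = psum k N t.
Proof.
move=> tN /subnKC <-; elim: (M - N)%N => [|d IH]; first by rewrite addn0.
rewrite addnS /psum big_ord_recr /= -/(psum _ _ _) IH term_le ?addr0//.
by apply: (le_trans tN); apply: dtime_le; rewrite leq_addr.
Qed.

Lemma psum_eq k N M t : t <= dtime N -> t <= dtime M -> psum k N t = psum k M t.
Proof.
move=> tN tM; have [NM|/ltnW MN] := leqP N M.
  by rewrite (psum_stable k tN NM).
by rewrite (psum_stable k tM MN).
Qed.

Lemma psum_block k n t : dtime n <= t -> psum k n.+1 t = term k n t.
Proof.
move=> tn; rewrite /psum big_ord_recr /= big1 ?add0r// => i _.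
by apply: term_ge; apply: le_trans tn; apply: dtime_le.
Qed.

(** All terms with index at least [N] vanish up to time [dtime N], so any such
    [N] gives the same partial sum. *)
Definition series_curve k t : E :=
  if t < 1 then psum k (xget 0%N [set N | t <= dtime N]) t else 0.

Lemma series_curveE k N t : t <= dtime N -> series_curve k t = psum k N t.
Proof.
move=> tN; rewrite /series_curve (le_lt_trans tN (dtime_lt1 N)).
apply: psum_eq => //.
exact: (xgetPex 0%N (ex_intro [set N | t <= dtime N] N tN)).
Qed.

Lemma series_curve_ge1 k t : 1 <= t -> series_curve k t = 0.
Proof. by rewrite /series_curve; case: ltP. Qed.

Lemma series_curve_block k n t : dtime n <= t -> t <= dtime n.+1 ->
  series_curve k t = term k n t.
Proof. by move=> nt tn; rewrite (series_curveE k tn) psum_block. Qed.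

Lemma series_curve_le0 k t : t <= 0 -> series_curve k t = 0.
Proof.
by move=> t0; rewrite (@series_curveE k 0%N) ?dtime0// /psum big_ord0.
Qed.

(** On the [n]-th block the division by [h] costs a factor [2 ^+ n.+1] and the
    [k]-th derivative of the term a factor [(2 ^+ n.+1) ^+ k]; the decay of
    [z n] outweighs both. *)
Lemma cder_series_curve1 k : cder (series_curve k) 1 0.
Proof.
rewrite /cder (@series_curve_ge1 k 1)//.
apply: seminorms_cvg0 => p ps.
have [_ pZ _] := ps.
have cD : continuous (D k) by move=> u; exact: cder_continuous (@DD k u).
have [M M0 DM] := bounded_support cD (@profile_le0 k) (@profile_ge1 k).
pose c := 2 * (M + 1) * 2 ^+ k.+1.
have c0 : 0 <= c by rewrite !mulr_ge0 ?exprn_ge0// addr_ge0.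
have [N _ Nz] := rz (seminormZ c0 ps) k.+1.
have dN : 0 < 1 - dtime N :> R by rewrite subr_gt0 dtime_lt1.
exists (1 - dtime N) => //= h.
rewrite /ball_ /= sub0r normrN => hd h0; rewrite subr0.
have [hp|hn] := ltP 0 h.
  by rewrite series_curve_ge1 ?lerDl ?ltW// scaler0 (seminorm0 ps).
have hneg : h < 0 by rewrite lt_neqAle h0.
have hN : dtime N < 1 + h by move: hd; rewrite ltr0_norm//; lra.
have h1 : 1 + h < 1 by rewrite -ltrBrDl subrr.
have h10 : 0 <= 1 + h.
  by apply/ltW; apply: le_lt_trans hN; rewrite -dtime0 dtime_le.
have [n [nh hn1]] := dtime_block h10 h1.
have Nn : (N <= n)%N.
  rewrite leqNgt; apply/negP => nN.
  by have := lt_trans hn1 (le_lt_trans (dtime_le nN) hN); rewrite ltxx.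
rewrite (series_curve_block k nh (ltW hn1)) /term !pZ.
have zn := Nz n Nn.
have pz0 := seminorm_ge0 (z n) ps.
have hV : `|h^-1| <= 2 ^+ n.+1.
  rewrite normfV -[leRHS]invrK lef_pV2 ?posrE ?invr_gt0 ?exprn_gt0 ?normr_gt0//.
  by move: hn1; rewrite /dtime ltr0_norm//; lra.
have P0 : 0 <= (2 ^+ n.+1) ^+ k :> R by rewrite !exprn_ge0.
rewrite (ger0_norm P0).
have B1 : `|h^-1| *
    ((2 ^+ n.+1) ^+ k * (`|D k (dparam n (1 + h)) : R| * p (z n)))
    <= 2 ^+ n.+1 * ((2 ^+ n.+1) ^+ k * (M * p (z n))).
  apply: ler_pM => //; first by rewrite !mulr_ge0.
  by rewrite ler_wpM2l// ler_wpM2r.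
apply: le_lt_trans B1 _.
rewrite mulrA -exprS -exprM.
have -> : (n.+1 * k.+1)%N = (k.+1 + k.+1 * n)%N by rewrite mulSn (mulnC n).
rewrite exprD; move: zn; rewrite /c.
set A := 2 ^+ k.+1; set B := 2 ^+ (k.+1 * n) => zn.
have A0 : 0 <= A by rewrite exprn_ge0.
have B0 : 0 <= B by rewrite exprn_ge0.
have q0 : 0 <= A * B * p (z n) by rewrite !mulr_ge0.
have -> : A * B * (M * p (z n)) = M * (A * B * p (z n)) by ring.
have : 2 * (M + 1) * (A * B * p (z n)) <= 1.
  by move: zn; rewrite (_ : _ * B = 2 * (M + 1) * (A * B * p (z n)))//; ring.
by set q := A * B * p (z n) in q0 *; nra.
Qed.

Lemma cder_series_curve k t : cder (series_curve k) t (series_curve k.+1 t).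
Proof.
have [t1|t1|->] := ltgtP t 1.
- have [N tN] := dtime_ex t1.
  rewrite (series_curveE k.+1 (ltW tN)).
  apply: cder_near_eq (@cder_psum k N t).
  near=> s; rewrite (@series_curveE k N)// ltW//; near: s; exact: lt_nbhsl.
- rewrite series_curve_ge1 ?ltW//.
  apply: (cder_near_eq _ (cder_cst (0 : E) t)).
  near=> s; rewrite series_curve_ge1// ltW//; near: s; exact: lt_nbhsr.
- by rewrite (@series_curve_ge1 k.+1)//; exact: cder_series_curve1.
Unshelve. all: by end_near. Qed.

End RapidSeries.

(** The sum over [n] of the bumps th (dparam n t) z_n, of which at most one is
    nonzero at each time. *)
Lemma rapid_curve (R : realType) (E : tvsType R) (th : R -> R^o)
    (z : nat -> E) :
  smooth_curve th -> (forall u : R, u <= 0 -> th u = 0) ->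
  (forall u, 1 <= u -> th u = 0) -> rapid z ->
  exists w : R -> E, [/\ smooth_curve w,
    forall n t, dtime n <= t -> t <= dtime n.+1 -> w t = th (dparam n t) *: z n,
    forall t, t <= 0 -> w t = 0 & forall t, 1 <= t -> w t = 0].
Proof.
move=> sth th0 th1 rz.
have [D DE DD] := smooth_curve_seq (@hausdorff_line R) sth.
rewrite -DE in th0 th1 *.
exists (series_curve D z 0); split.
- exact: (seq_smooth_curve (cder_series_curve DD th0 th1 rz)).
- move=> n t nt tn; rewrite (series_curve_block z DD th0 th1 _ nt tn)//.
  by rewrite /term expr0 scale1r.
- by move=> t; exact: series_curve_le0.
- by move=> t; exact: series_curve_ge1.
Qed.

(** * Curves as maps on the line *)

Section CurvesAsMaps.
Context {R : realType} {E : tvsType R}.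
Implicit Types (c : R -> E).

Lemma is_dderive_curve c t l : is_dderive (c : R^o -> E) t 1 l <-> cder c t l.
Proof.
rewrite /is_dderive /cder.
by under eq_fun do rewrite [_ *: (1 : R^o)]mulr1.
Qed.

(** By homogeneity, a derivative in the direction [v] of the line is [v] times
    the derivative of the curve. *)
Lemma iter_dderive_curve (D : nat -> R -> E) (vs : seq R^o) t :
  hausdorff_space E -> (forall k t, cder (D k) t (D k.+1 t)) ->
  iter_dderive (D 0%N : R^o -> E) vs t =
  (\prod_(v <- vs) (v : R)) *: D (size vs) t.
Proof.
move=> hE DD; elim/last_ind: vs t => [|vs v IH] t.
  by rewrite big_nil scale1r.
rewrite iter_dderive_rcons size_rcons -cats1 big_cat big_seq1 /=.
rewrite (funext IH); apply: is_dderiveE => //.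
have /is_dderiveZ := (is_dderive_curve (D (size vs)) t (D (size vs).+1 t)).2
  (DD _ t).
move=> /(_ v); rewrite [v *: 1]mulr1 => H.
have cst : (fun=> \prod_(j <- vs) (j : R)) @ (0 : R)^' -->
    \prod_(j <- vs) (j : R).
  exact: cvg_cst.
rewrite -scalerA; apply: cvg_trans (tvs_cvgZ cst H).
apply: near_eq_cvg; near=> h.
by rewrite -scalerBr !scalerA (mulrC h^-1).
Unshelve. all: by end_near. Qed.

Lemma smooth_curve_on c (U : set R^o) : hausdorff_space E -> smooth_curve c ->
  smooth_on U (c : R^o -> E).
Proof.
move=> hE sc; have [D DE DD] := smooth_curve_seq hE sc.
rewrite -DE => k; split.
  move=> vs v t _ _; rewrite (funext (fun t => iter_dderive_curve vs t hE DD)).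
  have H := (is_dderive_curve (D (size vs)) t (D (size vs).+1 t)).2 (DD _ t).
  have {H} := is_dderiveZ (a := v) H; rewrite [v *: 1]mulr1 => H.
  exists ((\prod_(j <- vs) (j : R)) *: (v *: D (size vs).+1 t)).
  have cst : (fun=> \prod_(j <- vs) (j : R)) @ (0 : R)^' -->
      \prod_(j <- vs) (j : R) by exact: cvg_cst.
  apply: cvg_trans (tvs_cvgZ cst H); apply: near_eq_cvg; near=> h.
  by rewrite -scalerBr !scalerA (mulrC h^-1).
move=> p _; apply: continuous_subspaceT.
have -> : (fun xv : R^o * {ptws 'I_p -> R^o} =>
    iter_dderive (D 0%N : R^o -> E) [seq xv.2 i | i <- enum 'I_p] xv.1) =
  (fun xv => (\prod_(i <- enum 'I_p) (xv.2 i : R)) *: D p xv.1).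
  apply/funext => xv; rewrite (iter_dderive_curve _ _ hE DD).
  by rewrite size_map size_enum_ord big_map.
pose X := (R^o * {ptws 'I_p -> R^o})%type.
move=> [t v].
have cD : (fun xv : X => D p xv.1) @ nbhs ((t, v) : X) --> D p t.
  apply: (@cvg_comp _ _ _ fst (D p) _ (nbhs t)); first exact: cvg_fst.
  exact: (cder_continuous (DD p t)).
have cP (r : seq 'I_p) : (fun xv : X => \prod_(i <- r) (xv.2 i : R))
    @ nbhs ((t, v) : X) --> \prod_(i <- r) (v i : R).
  elim: r => [|i r IH].
    by under eq_fun do rewrite big_nil; rewrite big_nil; exact: cvg_cst.
  under eq_fun do rewrite big_cons; rewrite big_cons.
  apply: cvgM => //.
  apply: (@cvg_comp _ _ _ snd (fun w : {ptws 'I_p -> R^o} => w i) _ (nbhs v)).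
    exact: cvg_snd.
  exact: (@proj_continuous _ (fun=> R^o) i v).
exact: (tvs_cvgZ (cP (enum 'I_p)) cD).
Unshelve. all: by end_near. Qed.

End CurvesAsMaps.

(** * One-jets of curves in a Lie group *)

Lemma Ck_on_C1 (R : realType) (F E : tvsType R) (U : set F) (f : F -> E) :
  open U -> smooth_on U f -> C1_on U f.
Proof. by move=> oU sf; exact: (iter_dderive_C1 oU sf [::]). Qed.

Section Charts.
Context {R : realType}.

Lemma bwd_cvg (M : topologicalType) (F : tvsType R) (a : chart M F) x :
  cod a x -> {for x, continuous (bwd a)}.
Proof.
move=> ax; have := @bwd_continuous _ _ _ a.
rewrite (continuous_open_subspace _ (@cod_open _ _ _ a)); apply.
by rewrite inE.
Qed.

(** The trivial condition [[set: M] (bwd a x)] makes this set the one on which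
    [mfd_Ck] with [W = setT] asks for differentiability. *)
Definition chart_domain (M N : topologicalType) (F E : tvsType R)
    (a : chart M F) (b : chart N E) (f : M -> N) : set F :=
  [set x | [/\ cod a x, [set: M] (bwd a x) & dom b (f (bwd a x))]].

Lemma chart_domain_open (M N : topologicalType) (F E : tvsType R)
    (a : chart M F) (b : chart N E) (f : M -> N) : continuous f ->
  open (chart_domain a b f).
Proof.
move=> cf; rewrite openE => x [ax _ bx].
have cfx : (f \o bwd a) @ x --> f (bwd a x).
  exact: (cvg_comp _ _ (bwd_cvg ax) (cf _)).
have := cfx _ (open_nbhs_nbhs (conj (@dom_open _ _ _ b) bx)).
have := open_nbhs_nbhs (conj (@cod_open _ _ _ a) ax).
by rewrite nbhs_filterE; apply: filterS2 => y ay by_; split.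
Qed.

Lemma mfd_smooth_continuous (M N : topologicalType) (F E : tvsType R)
    (A : set (chart M F)) (B : set (chart N E)) (f : M -> N) :
  mfd_smooth A B f -> continuous f.
Proof.
move=> /(_ 0%N)[cf _] x.
by move: cf; rewrite (continuous_open_subspace _ openT); apply; rewrite inE.
Qed.

Lemma mfd_smooth_chart (M N : topologicalType) (F E : tvsType R)
    (A : set (chart M F)) (B : set (chart N E)) (f : M -> N) a b :
  mfd_smooth A B f -> A a -> B b ->
  smooth_on (chart_domain a b f) (b \o f \o bwd a).
Proof. by move=> sf Aa Bb k; have [_] := sf k; exact. Qed.

End Charts.

Section LieGroupCharts.
Context {R : realType} {E : tvsType R} {G : preTopologicalGroupType}.
Variable A : set (chart G E).
Hypotheses (hE : hausdorff_space E) (hG : lie_group A).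

Let mulG (z : G * G) : G := (z.1 * z.2)%g.
Let invG (g : G) : G := (g^-1)%g.

Lemma mulG_continuous : continuous mulG.
Proof. by have [_ _ sm _] := hG; exact: mfd_smooth_continuous sm. Qed.

Lemma invG_continuous : continuous invG.
Proof. by have [_ _ _ si] := hG; exact: mfd_smooth_continuous si. Qed.

Definition mulc (a b c : chart G E) : E * E -> E :=
  c \o mulG \o bwd (prod_chart a b).
Definition mulc_dom (a b c : chart G E) : set (E * E) :=
  chart_domain (prod_chart a b) c mulG.
Definition invc (a c : chart G E) : E -> E := c \o invG \o bwd a.
Definition invc_dom (a c : chart G E) : set E := chart_domain a c invG.

Lemma mulc_dom_open a b c : open (mulc_dom a b c).
Proof. exact: (chart_domain_open _ _ mulG_continuous). Qed.

Lemma invc_dom_open a c : open (invc_dom a c).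
Proof. exact: (chart_domain_open _ _ invG_continuous). Qed.

Lemma mulc_smooth a b c : A a -> A b -> A c ->
  smooth_on (mulc_dom a b c) (mulc a b c).
Proof.
move=> Aa Ab Ac; have [_ _ sm _] := hG.
by apply: (mfd_smooth_chart sm) => //; exists a, b.
Qed.

Lemma invc_smooth a c : A a -> A c -> smooth_on (invc_dom a c) (invc a c).
Proof.
by move=> Aa Ac; have [_ _ _ si] := hG; exact: (mfd_smooth_chart si).
Qed.

Lemma chart_at g : exists2 a, A a & dom a g.
Proof. by have [_ [+ _ _] _ _] := hG; exact. Qed.

Lemma trans_smooth a b : A a -> A b ->
  smooth_on [set x | cod a x /\ dom b (bwd a x)] (b \o bwd a).
Proof. by move=> Aa Ab; have [_ [_ + _] _ _] := hG; case/(_ a b Aa Ab). Qed.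

Lemma trans_open (a b : chart G E) : open [set x | cod a x /\ dom b (bwd a x)].
Proof.
have idc : continuous (@id G) by move=> x; exact: cvg_id.
have := chart_domain_open a b idc.
by congr open; apply/seteqP; split => x /=; [case|case; split].
Qed.

(** The curve [c] has velocity [l] at time [t] in the chart [a].  Rules for jets
    need differentiability at the single time [t] only. *)
Definition jet (a : chart G E) (c : R -> G) (t : R) (l : E) :=
  [/\ {for t, continuous c}, dom a (c t) & cder (a \o c) t l].

Lemma jet_cst a g t : dom a g -> jet a (fun=> g) t 0.
Proof. by move=> ag; split => //; [exact: cvg_cst|exact: cder_cst]. Qed.

Lemma jet_near_dom a c t l : jet a c t l -> \forall s \near t, dom a (c s).
Proof.
case=> cc ac _.
exact: (cc _ (open_nbhs_nbhs (conj (@dom_open _ _ _ a) ac))).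
Qed.

Lemma jet_unique a c t l l' : jet a c t l -> jet a c t l' -> l = l'.
Proof. by move=> [_ _ cl] [_ _ cl']; exact: cder_unique cl cl'. Qed.

Lemma jet_mul a b c u v t l m : A a -> A b -> A c ->
  jet a u t l -> jet b v t m -> dom c (u t * v t)%g ->
  jet c (fun s => (u s * v s)%g) t
    (dderive (mulc a b c) (a (u t), b (v t)) (l, m)).
Proof.
move=> Aa Ab Ac ju jv cuv; have [cu au ul] := ju; have [cv bv vm] := jv.
split => //.
  exact: (cvg_comp _ _ (cvg_pair cu cv) (@mulG_continuous (u t, v t))).
have Wt : mulc_dom a b c (a (u t), b (v t)).
  split => //; first by split; exact: fwd_cod.
  by rewrite /= !fwdK.
have H := chain_rule (@mulc_dom_open a b c)
  (Ck_on_C1 (@mulc_dom_open a b c) (mulc_smooth Aa Ab Ac)) Wt (cder_pair ul vm).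
apply: cder_near_eq H; near=> s.
rewrite /mulc /= !fwdK//.
  by near: s; exact: jet_near_dom jv.
by near: s; exact: jet_near_dom ju.
Unshelve. all: by end_near. Qed.

Lemma jet_inv a c u t l : A a -> A c -> jet a u t l -> dom c (u t)^-1%g ->
  jet c (fun s => (u s)^-1%g) t (dderive (invc a c) (a (u t)) l).
Proof.
move=> Aa Ac ju cu; have [ctu au ul] := ju; split => //.
  exact: (cvg_comp _ _ ctu (@invG_continuous (u t))).
have Wt : invc_dom a c (a (u t)).
  by split => //; [exact: fwd_cod|rewrite fwdK].
have H := chain_rule (@invc_dom_open a c)
  (Ck_on_C1 (@invc_dom_open a c) (invc_smooth Aa Ac)) Wt ul.
apply: cder_near_eq H; near=> s.
by rewrite /invc /= fwdK//; near: s; exact: jet_near_dom ju.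
Unshelve. all: by end_near. Qed.

Lemma jet_mul0 a b c u v t : A a -> A b -> A c ->
  jet a u t 0 -> jet b v t 0 -> dom c (u t * v t)%g ->
  jet c (fun s => (u s * v s)%g) t 0.
Proof.
move=> Aa Ab Ac ju jv cuv; have := jet_mul Aa Ab Ac ju jv cuv.
by rewrite (dderive0 _ _ hE).
Qed.

(** A change of charts is a product with the constant curve 1. *)
Lemma jet_change0 a b c t : A a -> A b -> jet a c t 0 -> dom b (c t) ->
  jet b c t 0.
Proof.
move=> Aa Ab jc bc; have [d Ad d1] := chart_at 1%g.
have := jet_mul0 Aa Ad Ab jc (jet_cst t d1).
under eq_fun do rewrite mulg1.
by rewrite mulg1; exact.
Qed.

(** Locally, the mean value theorem in a chart puts the increment of the curve
    into every convex neighbourhood of 0; [cousin] makes this global. *)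
Lemma constant_of_jet0 (c : R -> G) (x y : R) : x <= y ->
  (forall t, x <= t -> t <= y -> exists2 a, A a & jet a c t 0) -> c x = c y.
Proof.
move=> xy jc; apply: (@cousin R x y (fun s t => c s = c t)) => //.
  by move=> s t u _ _ -> ->.
move=> t xt ty; have [a Aa ja] := jc t xt ty.
have [d /= d0 dd] := jet_near_dom ja.
exists d => // s u xs st tu uy sud.
move: (le_trans st tu); rewrite le_eqVlt => /predU1P[->//|su].
have adom r : s <= r -> r <= u -> dom a (c r).
  by move=> sr ru; apply: dd => /=; rewrite ltr_norml; lra.
suff: a (c s) = a (c u).
  move=> /(congr1 (bwd a)); rewrite !fwdK//; apply: adom => //; exact: ltW.
apply/eqP; rewrite eq_sym -subr_eq0; apply/eqP.
suff -> : a (c u) - a (c s) = (u - s) *: 0 by rewrite scaler0.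
suff <- : (u - s)^-1 *: (a (c u) - a (c s)) = 0.
  by rewrite scalerA mulfV ?scale1r// subr_eq0 gt_eqF.
apply/esym/(hausdorff_eq hE) => O /nbhs_convex[C [oC cC C0 CO]]; apply: CO.
apply: (@mean_value_convex R E (a \o c)) => // r sr ru.
have [b Ab jb] := jc r (le_trans xs sr) (le_trans ru uy).
by have [_ _ ?] := jet_change0 Ab Aa jb (adom r sr ru); exists 0.
Qed.

(** Up to constant factors, [(v s)^-1 * u s] is V^-1 U for the curves
    U s = u s * (u t)^-1 and V s = v s * (v t)^-1, which pass through 1 at time
    [t] with the same velocity.  So V^-1 U has the same jet as V^-1 V = 1. *)
Lemma jet_quotient a (u v : R -> G) t l : A a -> dom a 1%g ->
  jet a (fun s => u s * (u t)^-1)%g t l ->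
  jet a (fun s => v s * (v t)^-1)%g t l ->
  exists2 b, A b & jet b (fun s => (v s)^-1 * u s)%g t 0.
Proof.
move=> Aa a1 ju jv.
have jvV := jet_inv Aa Aa jv; rewrite mulgV invg1 in jvV.
have {}jvV := jvV a1.
have a11 : dom a (1 * 1)%g by rewrite mulg1.
have jvv := jet_mul Aa Aa Aa jvV jv; rewrite mulgV invg1 in jvv.
have {}jvv := jvv a11.
have jvu := jet_mul Aa Aa Aa jvV ju; rewrite !mulgV invg1 in jvu.
have {}jvu := jvu a11.
move: jvv; under eq_fun do rewrite mulVg.
move=> /(jet_unique (jet_cst t a1)) e0.
rewrite -e0 in jvu.
have [b1 Ab1 b1v] := chart_at (v t)^-1%g.
have [b2 Ab2 b2u] := chart_at (u t).
have [b Ab bvu] := chart_at ((v t)^-1 * u t)%g.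
exists b => //.
have j1 := jet_mul0 Ab1 Aa Ab1 (jet_cst t b1v) jvu.
rewrite !mulgV invg1 mulg1 mulg1 in j1; have {}j1 := j1 b1v.
have j2 := jet_mul0 Ab1 Ab2 Ab j1 (jet_cst t b2u).
rewrite !mulgV invg1 !mulg1 in j2; have {}j2 := j2 bvu.
congr (jet b _ t 0): j2; apply/funext => s.
by rewrite invgM invgK !mulgA mulVg mul1g mulgVK.
Qed.

End LieGroupCharts.

(** * Profiles of the blocks and fast subsequences *)

Section Profiles.
Context {R : realType}.

(** During the first half of a block [rho] passes from 0 to 1, and [drho] is
    its derivative.  The point at which the logarithmic derivative is evaluated
    has to return to 0 before the next block begins; it follows [th], which
    agrees with [rho] as long as [drho] does not vanish and falls back to 0
    during the second half. *)
Lemma profiles_exist : exists rho th drho : R -> R^o,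
  [/\ smooth_curve th /\ smooth_curve drho,
      forall u, cder rho u (drho u),
      (forall u : R, u <= 0 -> rho u = 0) /\
        (forall u : R, 1 <= u -> rho u = 1),
      forall u, 0 <= (rho u : R) <= 1 /\ 0 <= (th u : R) <= 1 &
      [/\ forall u : R, u <= 0 -> th u = 0, forall u : R, 1 <= u -> th u = 0,
          forall u : R, u <= 0 -> drho u = 0,
          forall u : R, 1 <= u -> drho u = 0 &
          forall u : R, drho u = 0 \/ th u = rho u]].
Proof.
pose rho u : R^o := step (2 * u + 0).
pose th u : R^o := step (2 * u + 0) *: (step (- 2 * u + 2) : R^o).
have srho : smooth_curve rho.
  by move=> k; apply: Ccurve_affine; exact: smooth_step.
have sth : smooth_curve th.
  by move=> k; apply: CcurveZ; apply: Ccurve_affine; exact: smooth_step.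
have [D D0 DD] := smooth_curve_seq (@hausdorff_line R) srho.
have cr u : cder rho u (D 1%N u) by rewrite -D0; exact: DD.
have sD : smooth_curve (D 1%N).
  exact: (@seq_smooth_curve _ _ (fun k => D k.+1) (fun k t => DD k.+1 t)).
have rho0 u : u <= 0 -> rho u = 0 by move=> u0; rewrite /rho step_le0//; lra.
have rho1 u : 1 / 2 <= u -> rho u = 1.
  by move=> u1; rewrite /rho step_ge1//; lra.
have d0 u : u <= 0 -> D 1%N u = 0.
  move=> u0; apply: (cder_eq0 (@hausdorff_line R) (cr u)) => d dp.
  exists (- (d / 2)); split.
  - by rewrite normrN ger0_norm; lra.
  - by rewrite oppr_eq0 gt_eqF// divr_gt0.
  - by rewrite !rho0//; lra.
have d1 u : 1 / 2 <= u -> D 1%N u = 0.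
  move=> u0; apply: (cder_eq0 (@hausdorff_line R) (cr u)) => d dp.
  exists (d / 2); split.
  - by rewrite ger0_norm; lra.
  - by rewrite gt_eqF// divr_gt0.
  - by rewrite !rho1//; lra.
exists rho, th, (D 1%N); split => //.
- by split=> // u u1; apply: rho1; lra.
- move=> u; rewrite step_ge0 step_le1 /th /GRing.scale /=; split => //.
  by rewrite mulr_ge0 ?step_ge0// mulr_ile1 ?step_ge0 ?step_le1.
- split => //.
  + by move=> u u0; rewrite /th step_le0 ?scale0r//; lra.
  + by move=> u u0; rewrite /th [step (- 2 * u + 2)]step_le0 ?scaler0//; lra.
  + by move=> u u1; apply: d1; lra.
  + move=> u; have [u1|u1] := leP (1 / 2) u; first by left; exact: d1.
    right; rewrite /th [step (- 2 * u + 2)]step_ge1; last by lra.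
    by rewrite /GRing.scale /= mulr1.
Qed.

End Profiles.

Section FastSubsequence.
Context {R : realType}.

Lemma fast_subsequence (lam : nat -> nat -> R) (T : nat) :
  lam mn.1 mn.2 @[mn --> (\oo, \oo)] --> 0 ->
  exists K : nat -> nat, [/\ forall n, (n <= K n)%N, forall n, (T <= K n)%N &
    forall n, `|lam (K n.+1) (K n)| <= 2 ^- (n * n)].
Proof.
move=> lamcvg.
have thr n : exists N, forall m m', (N <= m)%N -> (N <= m')%N ->
    `|lam m m'| <= 2 ^- (n * n).
  have e0 : 0 < 2 ^- (n * n) :> R by rewrite invr_gt0 exprn_gt0.
  move/cvgrPdist_le : lamcvg => /(_ _ e0) [[P Q] /= [[N1 _ NP] [N2 _ NQ]] PQ].
  exists (maxn N1 N2) => m m' mN m'N.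
  have := PQ (m, m'); rewrite /= sub0r normrN; apply; split.
    by apply: NP => /=; rewrite (leq_trans _ mN)// leq_maxl.
  by apply: NQ => /=; rewrite (leq_trans _ m'N)// leq_maxr.
have [f fP] := choice thr.
pose K n := (T + n + \sum_(i < n.+1) f i)%N.
have fK n : (f n <= K n)%N by rewrite /K big_ord_recr /= addnA leq_addl.
exists K; split.
- by move=> n; rewrite /K addnAC leq_addl.
- by move=> n; rewrite /K -addnA leq_addr.
- move=> n; apply: fP => //; apply: (leq_trans (fK n)).
  rewrite /K [X in (_ <= _ + X)%N]big_ord_recr /= addnS addSn leqW//.
  by rewrite leq_add2l leq_addr.
Qed.

Lemma fast_rapid (E : tvsType R) (x : nat -> E) :
  (forall p, continuous_seminorm p -> exists c : R,
    \forall n \near \oo, p (x n) <= c * 2 ^- (n * n)) -> rapid x.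
Proof.
move=> xfast p ps k; have [c cx] := xfast p ps.
have c2 : \forall n \near \oo, c <= 2 ^+ n.
  exists (Num.bound `|c|) => // n /= cn.
  apply: (le_trans (ler_norm c)); apply: ltW.
  apply: (lt_le_trans (archi_boundP (normr_ge0 c))).
  by rewrite -natrX ler_nat (leq_trans cn)// ltnW// ltn_expl.
near=> n.
have kn : (k.+1 <= n)%N by near: n; exact: nbhs_infty_ge.
have cxn : p (x n) <= c * 2 ^- (n * n) by near: n.
have cn : c <= 2 ^+ n by near: n.
have t0 m : 0 < 2 ^+ m :> R by rewrite exprn_gt0.
apply: (@le_trans _ _ (2 ^+ n * 2 ^- (n * n) * 2 ^+ (k * n))).
  rewrite ler_pM2r//; apply: (le_trans cxn).
  by rewrite ler_pM2r ?invr_gt0.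
rewrite mulrAC ler_pdivrMr// mul1r -exprD -mulSn.
by rewrite ler_weXn2l ?ler1n// leq_mul2r kn orbT.
Unshelve. all: by end_near. Qed.

End FastSubsequence.

(** * Evolution through a rapidly decreasing sequence *)

Section Evolution.
Context {R : realType} {E : tvsType R} {G : preTopologicalGroupType}.
Variable A : set (chart G E).
Hypotheses (hE : hausdorff_space E) (hG : lie_group A).
Variable Xi : chart G E.
Hypotheses (hXi : A Xi) (hdom : dom Xi 1%g) (hzero : Xi 1%g = 0).

(** The coordinates of the tangent vector at 1 whose coordinate in the chart
    [Xi] is [xi]. *)
Definition unit_coord (xi : E) (b : chart G E) : E :=
  if pselect (A b /\ dom b 1%g) then dderive (b \o bwd Xi) (Xi 1%g) xi else 0.

Lemma unit_coordE xi b : A b -> dom b 1%g ->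
  unit_coord xi b = dderive (b \o bwd Xi) (Xi 1%g) xi.
Proof. by move=> Ab b1; rewrite /unit_coord; case: pselect => // -[]. Qed.

(** Both sides are the derivative at 0 of the curve Xi^-1 (Xi 1 + t xi), read in
    the chart [b]. *)
Lemma unit_coord_transition xi a b : A a -> A b -> dom a 1%g -> dom b 1%g ->
  unit_coord xi b = dderive (b \o bwd a) (a 1%g) (unit_coord xi a).
Proof.
move=> Aa Ab a1 b1; rewrite !unit_coordE//.
have cderX c : A c -> dom c 1%g ->
    cder (fun t : R => c (bwd Xi (Xi 1%g + t *: xi))) 0
      (dderive (c \o bwd Xi) (Xi 1%g) xi).
  move=> Ac c1; apply: (is_dderive_cder (f := c \o bwd Xi)); apply: dderiveP.
  have [df _] := Ck_on_C1 (@trans_open _ _ _ Xi c) (trans_smooth hG hXi Ac).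
  by apply: df => /=; split; [exact: fwd_cod|rewrite fwdK].
have line : (fun t : R => Xi 1%g + t *: xi) @ 0 --> Xi 1%g.
  rewrite -[X in _ --> X]addr0 -[X in _ + X](scale0r xi).
  apply: tvs_cvgD; first exact: cvg_cst.
  by apply: tvs_cvgZ; [exact: cvg_id|exact: cvg_cst].
have nXi : nbhs (Xi 1%g) [set x | cod Xi x /\ dom a (bwd Xi x)].
  apply: open_nbhs_nbhs; split; first exact: trans_open.
  by split; [exact: fwd_cod|rewrite fwdK].
have e0 : a (bwd Xi (Xi 1%g + (0 : R) *: xi)) = a 1%g.
  by rewrite scale0r addr0 fwdK.
have H := chain_rule (@trans_open _ _ _ a b)
  (Ck_on_C1 (@trans_open _ _ _ a b) (trans_smooth hG Aa Ab)) _ (cderX a Aa a1).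
rewrite e0 in H.
have {}H := H (conj (fwd_cod a1) (eq_ind_r (dom b) b1 (fwdK a1))).
apply: (cder_unique hE (cderX b Ab b1)); apply: cder_near_eq H.
near=> t; rewrite /= fwdK//.
suff [] : [set x | cod Xi x /\ dom a (bwd Xi x)] (Xi 1%g + t *: xi) by [].
by near: t; exact: (line _ nXi).
Unshelve. all: by end_near. Qed.

Lemma unit_coord_junk xi a : ~ (A a /\ dom a 1%g) -> unit_coord xi a = 0.
Proof. by rewrite /unit_coord; case: pselect. Qed.

Definition unit_tangent (xi : E) : tangent A 1%g :=
  Tangent (@unit_coord_transition xi) (@unit_coord_junk xi).

Lemma unit_tangent_Xi xi : Defs.coord (unit_tangent xi) Xi = xi.
Proof.
rewrite /= unit_coordE//; apply: is_dderiveE => //.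
apply: (@is_dderive_near _ _ _ (cod Xi) id).
- exact: cod_open.
- exact: fwd_cod.
- by move=> y Xy; rewrite /= bwdK.
rewrite /is_dderive.
apply: (@cvg_trans _ ((fun=> xi) @ (0 : R)^')); last exact: cvg_cst.
apply: near_eq_cvg; near=> h.
have h0 : h != 0 by near: h; exact: nbhs_dnbhs_neq.
by rewrite /= addrC addKr scalerA mulVf// scale1r.
Unshelve. all: by end_near. Qed.

Lemma unit_tangent_smooth (xi : R -> E) : smooth_curve xi ->
  tangent_curve_smooth 0 1 (fun t : R^o => unit_tangent (xi t)).
Proof.
move=> sxi; exists (-1), 2; split; [lra|lra|] => a Aa a1.
apply: smooth_curve_on => // k.
under eq_fun do rewrite /= unit_coordE//.
have := @iter_dderive_Ccurve R E E _ _ hE (@trans_open _ _ _ Xi a)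
  (trans_smooth hG hXi Aa) k (fun=> Xi 1%g) [:: xi].
apply.
- by move=> t; split; [exact: fwd_cod|rewrite fwdK].
- exact: Ccurve_cst.
- by move=> d; rewrite mem_seq1 => /eqP ->.
Qed.

Lemma curve_C1_jet (mu : R^o -> G) t a : curve_Ck A 1 0 1 mu ->
  0 <= t -> t <= 1 -> A a -> dom a (mu t) ->
  jet a mu t (dderive (a \o mu : R^o -> E) t 1).
Proof.
move=> [r [s [r0 s1 [cmu dmu]]]] t0 t1 Aa at_.
have tI : [set` `]r, s[%R] t by rewrite /= in_itv /=; apply/andP; lra.
split => //.
  move: cmu; rewrite continuous_open_subspace; last exact: interval_open.
  by apply; rewrite inE.
have [df _] := dmu _ a erefl Aa.
have [|l hl] := df [::] 1 t erefl; first by [].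
apply/is_dderive_curve/dderiveP; exists l; exact: hl.
Qed.

(** The right translation by (mu t)^-1 in charts is a partial map of the
    multiplication, so [jet_mul] with a constant factor computes the tangent map
    in the definition of [right_logder]. *)
Lemma right_logder_jet (mu : R^o -> G) t (xi : tangent A 1%g) :
  curve_Ck A 1 0 1 mu -> 0 <= t -> t <= 1 -> right_logder mu t xi ->
  jet Xi (fun s => mu s * (mu t)^-1)%g t (Defs.coord xi Xi).
Proof.
move=> cmu t0 t1 [v vel [_ tm]].
have [a Aa amu] := chart_at hG (mu t).
have [b Ab bmu] := chart_at hG (mu t)^-1%g.
rewrite (tm a Xi Aa amu hXi hdom) (vel a Aa amu).
have j := curve_C1_jet cmu t0 t1 Aa amu.
have Xi1 : dom Xi (mu t * (mu t)^-1)%g by rewrite mulgV.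
have := jet_mul hG Aa Ab hXi j (jet_cst t bmu) Xi1.
congr (jet Xi _ t _).
set l := dderive _ t 1; set W := mulc_dom a b Xi.
have Wt : W (a (mu t), b (mu t)^-1%g).
  split => //; first by split; exact: fwd_cod.
  by rewrite /= !fwdK.
have [df _] := Ck_on_C1 (@mulc_dom_open _ _ _ _ hG a b Xi)
  (mulc_smooth hG Aa Ab hXi).
have /dderiveP := df _ (l, 0) Wt.
set L := dderive (mulc a b Xi) _ _ => HL.
apply/esym/is_dderiveE => //.
apply: cvg_trans HL; apply: near_eq_cvg; near=> h.
by rewrite /mulc /= scaler0 addr0 !fwdK.
Unshelve. all: by end_near. Qed.

(** The curve [mu] evolves along the logarithmic derivative [xi], which on the
    [n]-th block is that of the path from 1 to [bwd Xi (x n)] along the segment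
    from 0 to [x n]. *)
Lemma evolution_through (x : nat -> E) : Cinfty_semiregular A -> rapid x ->
  (forall n (s : R), 0 <= s <= 1 -> invc_dom Xi Xi (s *: x n)) ->
  exists2 mu : R -> G, {for 1, continuous mu} &
    forall n, mu (dtime n.+1) = (bwd Xi (x n) * mu (dtime n))%g.
Proof.
move=> sreg rx xV.
have V0 : invc_dom Xi Xi 0.
  by have := xV 0%N 0; rewrite lexx ler01 scale0r; exact.
have [rho [th [drho [[sth sdrho] crho [rho0 rho1] b01
  [th0 th1 dr0 dr1 drth]]]]] := @profiles_exist R.
have [al [sal alE al0 al1]] := rapid_curve sth th0 th1 rx.
have [be [sbe beE be0 be1]] := rapid_curve sdrho dr0 dr1 (rapid_scale rx).
have alV t : invc_dom Xi Xi (al t).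
  have [t0|/ltW t0] := leP t 0; first by rewrite al0.
  have [t1|t1] := leP 1 t; first by rewrite al1.
  have [n [nt /ltW tn]] := dtime_block t0 t1.
  by rewrite (alE n t nt tn); apply: xV; have [] := b01 (dparam n t).
(* The multiplication and the inversion in the chart [Xi]. *)
pose M := mulc Xi Xi Xi; pose I := invc Xi Xi.
have oM := @mulc_dom_open _ _ _ _ hG Xi Xi Xi.
have sM := mulc_smooth hG hXi hXi hXi.
have oI := @invc_dom_open _ _ _ _ hG Xi Xi.
have sI := invc_smooth hG hXi hXi.
have inM y : invc_dom Xi Xi y -> mulc_dom Xi Xi Xi (y, I y).
  move=> [cy _ dy]; split => //; first by split => //; exact: fwd_cod.
  by rewrite /I /invc /= fwdK// mulgV.
have sIal : smooth_curve (fun t => I (al t)).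
  move=> k; apply: (@iter_dderive_Ccurve R E E _ _ hE oI sI k al [::]) => //.
(* At a point [(y, I y)] the derivative of [M] in a direction [(b, 0)] is the
   right translation of the vector [b] at [y] to the unit. *)
pose xi t := dderive M (al t, I (al t)) (be t, 0).
have sxi : smooth_curve xi.
  move=> k; have := @iter_dderive_Ccurve R _ E _ _ hE oM sM k
    (fun t => (al t, I (al t))) [:: (fun t => (be t, 0))].
  apply.
  - by move=> t; apply: inM.
  - by apply: Ccurve_pair; [exact: sal|exact: sIal].
  - move=> d; rewrite mem_seq1 => /eqP ->.
    by apply: Ccurve_pair; [exact: sbe|exact: Ccurve_cst].
have [mu cmu lmu] := sreg _ (unit_tangent_smooth sxi).
exists mu.
  have [a Aa amu] := chart_at hG (mu 1).
  by have [] := curve_C1_jet cmu ler01 (lexx _) Aa amu.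
have muJ t : 0 <= t -> t <= 1 ->
    jet Xi (fun s => mu s * (mu t)^-1)%g t (xi t).
  move=> t0 t1; rewrite -[xi t]unit_tangent_Xi.
  by apply: right_logder_jet => //; apply: lmu; rewrite t0.
move=> n.
(* The path [nu] from 1 to [bwd Xi (x n)], and its logarithmic derivative. *)
pose c s : E := rho (dparam n s) *: x n.
pose nu s := bwd Xi (c s).
have cV s : invc_dom Xi Xi (c s) by apply: xV; have [] := b01 (dparam n s).
have ccod s : cod Xi (c s) by have [] := cV s.
have cc t : cder c t ((2 ^+ n.+1 *: drho (dparam n t)) *: x n).
  have H := cder_affine (crho (dparam n t)).
  have := cderZ H (cder_cst (x n) t).
  by rewrite scaler0 add0r.
have nuJ t : jet Xi nu t ((2 ^+ n.+1 *: drho (dparam n t)) *: x n).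
  split; last 1 first.
  - have -> : Xi \o nu = c by apply/funext => s; rewrite /= bwdK.
    exact: cc.
  - exact: (cvg_comp _ _ (cder_continuous (cc t)) (bwd_cvg (ccod t))).
  - exact: bwd_dom.
have nuxi t : dtime n <= t -> t <= dtime n.+1 ->
    jet Xi (fun s => nu s * (nu t)^-1)%g t (xi t).
  move=> nt tn.
  have dnu : dom Xi (nu t)^-1%g by have [] := cV t.
  have d1 : dom Xi (nu t * (nu t)^-1)%g by rewrite mulgV.
  have := jet_mul hG hXi hXi hXi (nuJ t) (jet_cst t dnu) d1.
  congr (jet Xi _ t _).
  rewrite /xi (alE n t nt tn) (beE n t nt tn) /nu bwdK// -/M.
  rewrite scalerA.
  (* Either both directions vanish or both base points agree. *)
  have [->|->] := drth (dparam n t).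
    by rewrite scaler0 mul0r !scale0r !dderive0.
  by rewrite [_ * 2 ^+ _]mulrC.
have nn : dtime n <= dtime n.+1 :> R by apply: dtime_le.
have n0 : 0 <= dtime n :> R by rewrite -dtime0 dtime_le.
have n1 : dtime n.+1 <= 1 :> R by exact/ltW/dtime_lt1.
have kappa t : dtime n <= t -> t <= dtime n.+1 ->
    exists2 a, A a & jet a (fun s => (nu s)^-1 * mu s)%g t 0.
  move=> nt tn; apply: (jet_quotient hE hG hXi hdom) (nuxi t nt tn).
  by apply: muJ; [exact: le_trans nt|exact: le_trans n1].
have := constant_of_jet0 hE hG nn kappa; rewrite /nu /c dparam0 dparam1.
rewrite rho0// rho1// scale0r scale1r -hzero fwdK// invg1 mul1g => ->.
by rewrite mulgA mulgV mul1g.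
Qed.

End Evolution.

(** * Mackey completeness *)

Lemma dtime_cvg (R : realType) : dtime n @[n --> \oo] --> (1 : R).
Proof.
apply/cvgrPdist_lt => e e0.
have [|N Ne] := @dtime_ex R (1 - e); first by lra.
exists N => // n /= Nn; have := @dtime_lt1 R n; have := @dtime_le R _ _ Nn.
by move=> Nn' n1; rewrite ger0_norm; lra.
Qed.

Theorem theoremI (R : realType) (E : tvsType R) (hE : hausdorff_space E)
    (G : preTopologicalGroupType) (A : set (chart G E)) (hG : lie_group A)
    (Xi : chart G E) (hXi : A Xi) (hdom : dom Xi 1%g) (hzero : Xi 1%g = 0)
    (hconvex : convex_set (cod Xi)) :
  Cinfty_semiregular A -> mackey_complete Xi.
Proof.
move=> sreg g [c [l [lam [c0 lam0 lamcvg mc]]]].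
have small p : continuous_seminorm p -> exists N, forall m n,
    (N <= m)%N -> (N <= n)%N ->
    dom Xi ((g m)^-1 * g n)%g /\ p (Xi ((g m)^-1 * g n)%g) < 1.
  move=> ps; have cp := c0 p ps.
  have e0 : 0 < (c p + 1)^-1 by rewrite invr_gt0 ltr_wpDl.
  move/cvgrPdist_lt : lamcvg => /(_ _ e0) [[P Q] /= [[N1 _ NP] [N2 _ NQ]] PQ].
  exists (maxn (maxn N1 N2) (l p)) => m n.
  rewrite !geq_max => /andP[/andP[mN1 _] ml] /andP[/andP[_ nN2] nl].
  have [dXi pXi] := mc p ps m n ml nl; split => //; apply: le_lt_trans pXi _.
  have /= := PQ (m, n) (conj (NP _ mN1) (NQ _ nN2)).
  rewrite sub0r normrN ger0_norm// -[X in _ < X]div1r ltr_pdivlMr ?ltr_wpDl//.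
  apply: le_lt_trans; rewrite mulrDr mulr1 mulrC lerDl.
  exact: lam0.
have Xi0 : cod Xi 0 by rewrite -hzero; exact: fwd_cod.
have bXi0 : bwd Xi 0 = 1%g by rewrite -hzero fwdK.
have V0 : nbhs 0 (invc_dom Xi Xi).
  apply: open_nbhs_nbhs; split; first exact: invc_dom_open hG _ _.
  by split => //; rewrite bXi0 invg1.
have [p0 p0s p0V] := nbhs0_seminorm V0.
have [N0 N0p] := small p0 p0s.
(* Indices from [N0] on keep the segments from 0 to [x n] inside the domain of
   the inversion in the chart [Xi]. *)
have [K [nK TK lamK]] := fast_subsequence N0 lamcvg.
pose x n := Xi ((g (K n.+1))^-1 * g (K n))%g.
have xdom n : dom Xi ((g (K n.+1))^-1 * g (K n))%g.
  by have [] := N0p _ _ (TK n.+1) (TK n).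
have rx : rapid x.
  apply: fast_rapid => p ps; exists (c p).
  exists (l p) => // n /= ln.
  have [_ pXi] := mc p ps (K n.+1) (K n) (leq_trans ln (ltnW (nK n.+1)))
    (leq_trans ln (nK n)).
  apply: (le_trans pXi); rewrite ler_wpM2l ?c0//.
  exact: le_trans (ler_norm _) (lamK n).
have xV n (s : R) : 0 <= s <= 1 -> invc_dom Xi Xi (s *: x n).
  move=> /andP[s0 s1]; apply: p0V; have [_ pZ _] := p0s.
  have [_ px] := N0p _ _ (TK n.+1) (TK n).
  rewrite pZ ger0_norm//; apply: le_lt_trans px.
  by rewrite ler_piMl// (seminorm_ge0 _ p0s).
have [mu mu1 muS] := evolution_through hE hG hXi hdom hzero sreg rx xV.
have inv n : (g (K n) * mu (dtime n) = g (K 0) * mu (dtime 0))%g.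
  by elim: n => // n <-; rewrite muS /x fwdK// !mulgA mulgV mul1g.
pose h := (g (K 0) * mu (dtime 0) * (mu 1%R)^-1)%g.
have mulC := mulG_continuous hG; have invC := invG_continuous hG.
have gK : g (K n) @[n --> \oo] --> h.
  have -> : (fun n => g (K n)) =
      (fun n => (g (K 0) * mu (dtime 0) * (mu (dtime n))^-1)%g).
    by apply/funext => n; rewrite -(inv n) mulgK.
  have cst : (fun=> (g (K 0) * mu (dtime 0))%g) @ \oo -->
      (g (K 0) * mu (dtime 0))%g.
    exact: cvg_cst.
  have muV : (mu (dtime n))^-1%g @[n --> \oo] --> (mu 1%R)^-1%g.
    exact: (cvg_comp _ _ (cvg_comp _ _ (@dtime_cvg R) mu1) (invC (mu 1))).
  exact: (cvg_comp _ _ (cvg_pair cst muV) (mulC (_, _))).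
exists h.
pose y n := Xi ((g (K n))^-1 * g n)%g.
have y0 : y n @[n --> \oo] --> 0.
  apply: seminorms_cvg0 => p ps; have [N Np] := small p ps.
  by exists N => // n /= Nn; have [] := Np _ _ (leq_trans Nn (nK n)) Nn.
have by1 : bwd Xi (y n) @[n --> \oo] --> 1%g.
  by rewrite -bXi0; exact: (cvg_comp _ _ y0 (bwd_cvg Xi0)).
have : (g (K n) * bwd Xi (y n))%g @[n --> \oo] --> (h * 1)%g.
  exact: (cvg_comp _ _ (cvg_pair gK by1) (mulC (h, 1%g))).
rewrite mulg1 => gKy; apply: cvg_trans gKy; apply: near_eq_cvg.
exists N0 => // n /= Nn.
have [yd _] := N0p _ _ (TK n) Nn.
by rewrite /y fwdK// mulgA mulgV mul1g.
Qed.
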